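(* Let $K$ be a number field, and let $(V,\psi)$, $D$, $(V_{\mathrm{DR}},\psi_{\mathrm{DR}})$ and the family of $l$-adic representations $\rho_l\colon G_K\to \mathrm{GIso}_{(V_l,\psi_l)}(\mathbb{Q}_l)$ satisfy the standing assumptions listed in the context, of weight $n\neq0$. Assume the Algebraic Sato--Tate Conjecture for the groups $\widetilde{G_{l,L,1}^{\mathrm{alg}}}$ (stated in the context). Let $$\mathrm{P}_{\mathrm{ST}}(V,\psi):=\mathrm{AST}_K(V,\psi)/\widetilde{\mathrm{AST}_K}(V,\psi)=\mathrm{ST}_K(V,\psi)/\widetilde{\mathrm{ST}_K}(V,\psi).$$ (a) If $\mathrm{P}_{\mathrm{ST}}(V,\psi)$ is nontrivial, i.e. $-\mathrm{Id}_V\notin\widetilde{\mathrm{ST}_K}(V,\psi)$, then the Sato--Tate Conjecture for $\mathrm{ST}_K(V,\psi)$ does not hold. (b) If $\mathrm{P}_{\mathrm{ST}}(V,\psi)$ is trivial, i.e. $-\mathrm{Id}_V\in\widetilde{\mathrm{ST}_K}(V,\psi)$, then the Sato--Tate Conjecture for $\mathrm{ST}_K(V,\psi)$ and the Sato--Tate Conjecture for $\widetilde{\mathrm{ST}_K}(V,\psi)$ are equivalent.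
   Context: Standing setting. $K$ is a number field, $G_K=\mathrm{Gal}(\overline K/K)$. $(V,\psi)$ is a rational polarized pure Hodge structure of weight $n$, $\psi\colon V\times V\to\mathbb{Q}(-n)$. $\mathrm{GIso}_{(V,\psi)}$ is the group of $g\in\mathrm{GL}_V$ with $\psi(gv,gw)=\chi(g)\psi(v,w)$ for some $\chi(g)\in\mathbb{G}_m$ and all $v,w$; $\mathrm{Iso}_{(V,\psi)}=\ker\chi$. For each prime $l$, $V_l=V\otimes\mathbb{Q}_l$, $\psi_l=\psi\otimes\mathbb{Q}_l$ (with the analogous groups), and $\rho_l$ is a continuous representation of $G_K$ on $V_l$ for which $\psi_l\colon V_l\times V_l\to\mathbb{Q}_l(-n)$ is $G_K$-equivariant. Assumptions: (D1) $D\subseteq\mathrm{End}_{\mathbb{Q}}(V)$ is a ring whose action on $V\otimes\mathbb{C}$ preserves the Hodge decomposition. (D2) $D$ has a structure of discrete $G_K$-module, giving $\rho_e\colon G_K\to\mathrm{Aut}_{\mathbb{Q}}(D)$. De Rham data: a $K$-vector space $V_{\mathrm{DR}}$ with a nondegenerate bilinear pairing $\psi_{\mathrm{DR}}\colon V_{\mathrm{DR}}\times V_{\mathrm{DR}}\to K(-n)$, a decreasing filtration $F^iV_{\mathrm{DR}}$ with graded pieces $G^iV_{\mathrm{DR}}$, and for each embedding $\sigma\colon K\to\mathbb{C}$ an isomorphism $V\otimes_{\mathbb{Q}}\mathbb{C}\simeq V_{\mathrm{DR}}\otimes_{K,\sigma}\mathbb{C}$ compatible with the forms and with the Hodge filtrations.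 (DR1) There is a canonical embedding $D\subseteq\mathrm{End}_{\overline K}(V_{\mathrm{DR}}\otimes_K\overline K)$ compatible with these comparison isomorphisms. (DR2) The action of $D$ preserves the decomposition $V\otimes\mathbb{C}=\bigoplus_i G^iV_{\mathrm{DR}}\otimes_{K,\sigma}\mathbb{C}$. (R1) $(\rho_l)_l$ is strictly compatible in the sense of Serre and $\rho_l$ is of Hodge--Tate type at every prime of $\mathcal{O}_K$ over $l$. (R2) For each $l$ and each prime $v$ outside a finite set containing all primes over $l$, the eigenvalues of an (arithmetic) Frobenius at $v$ have complex absolute value $q_v^{-n/2}$. (R3) For each prime $\lambda\mid l$ there is a Hodge--Tate decomposition $V_l\otimes_{\mathbb{Q}_l}\mathbb{C}_l=\bigoplus_i G^iV_{\mathrm{DR}}\otimes_K\mathbb{C}_l(i-n)$, $\mathbb{C}_l=\widehat{\overline K}_\lambda$. (R4) $\rho_l(\sigma)(\beta v)=\sigma(\beta)\rho_l(\sigma)(v)$ for $\beta\in D$, $v\in V_l$, $\sigma\in G_K$, and the action of $D$ on $V_l\otimes\mathbb{C}_l$ is compatible with (R3). For a finite extension $L/K$, $G_{l,L}^{\mathrm{alg}}$ is the Zariski closure of $\rho_l(G_L)$ in $\mathrm{GIso}_{(V_l,\psi_l)}$ and $G_{l,L,1}^{\mathrm{alg}}:=G_{l,L}^{\mathrm{alg}}\cap\mathrm{Iso}_{(V_l,\psi_l)}$. Put $W_l:=V_l\oplus\mathbb{Q}_l(1)$, $\widetilde\rho_l(g)=(\rho_l(g),\chi_c(g))$ ($\chi_c$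 the $l$-adic cyclotomic character). $\widetilde{G_{l,L}^{\mathrm{alg}}}\subset G_{l,L}^{\mathrm{alg}}\times\mathbb{G}_m$ is the Zariski closure of $\widetilde\rho_l(G_L)$ in $\mathrm{GL}_{W_l}$, $N$ its projection to $\mathbb{G}_m$, and $\widetilde{G_{l,L,1}^{\mathrm{alg}}}:=\ker N$, which the first projection embeds in $G_{l,L,1}^{\mathrm{alg}}\subset\mathrm{Iso}_{(V_l,\psi_l)}$. Algebraic Sato--Tate Conjecture for $\widetilde{G_{l,L,1}^{\mathrm{alg}}}$: for every finite extension $L/K$ there is a reductive algebraic group $\widetilde{\mathrm{AST}_L}(V,\psi)\subset\mathrm{Iso}_{(V,\psi)}$ over $\mathbb{Q}$, natural in $L$, and for every $l$ a natural-in-$L$ isomorphism $\widetilde{\mathrm{ast}}_{l,L}\colon\widetilde{G_{l,L,1}^{\mathrm{alg}}}\to\widetilde{\mathrm{AST}_L}(V,\psi)_{\mathbb{Q}_l}$ through which the embedding $\widetilde{G_{l,L,1}^{\mathrm{alg}}}\subset\mathrm{Iso}_{(V_l,\psi_l)}$ factors. (Natural: for $L\subset L'$ there are compatible natural monomorphisms from the groups over $L'$ to those over $L$.) Under this conjecture put $\mathrm{AST}_K(V,\psi):=\widetilde{\mathrm{AST}_K}(V,\psi)\cup-\mathrm{Id}_V\widetilde{\mathrm{AST}_K}(V,\psi)$; then $G_{l,K,1}^{\mathrm{alg}}\simeq\mathrm{AST}_K(V,\psi)_{\mathbb{Q}_l}$. $\mathrm{ST}_K(V,\psi)$ (resp.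 $\widetilde{\mathrm{ST}_K}(V,\psi)$) is a maximal compact subgroup of $\mathrm{AST}_K(V,\psi)(\mathbb{C})$ (resp. $\widetilde{\mathrm{AST}_K}(V,\psi)(\mathbb{C})$), chosen so that $\mathrm{ST}_K(V,\psi)=\widetilde{\mathrm{ST}_K}(V,\psi)\cup-\mathrm{Id}_V\widetilde{\mathrm{ST}_K}(V,\psi)$. Frobenius classes: fix $l$ and an embedding $\mathbb{Q}_l\subset\mathbb{C}$. For a prime $v$ of $\mathcal{O}_K$ outside the finite set of excluded primes, let $s_v$ be the semisimple part of the normalized Frobenius $q_v^{n/2}\rho_l(\mathrm{Fr}_v)\in G_{l,K,1}^{\mathrm{alg}}(\mathbb{C})\simeq\mathrm{AST}_K(V,\psi)(\mathbb{C})$, and $\tilde s_v$ the semisimple part of $(q_v^{n/2}\mathrm{Id}_{V_l},q_v^{-1}\mathrm{Id}_{\mathbb{Q}_l(1)})\widetilde\rho_l(\mathrm{Fr}_v)\in\widetilde{G_{l,K,1}^{\mathrm{alg}}}(\mathbb{C})\simeq\widetilde{\mathrm{AST}_K}(V,\psi)(\mathbb{C})$. Their conjugacy classes have eigenvalues of absolute value 1 and determine conjugacy classes $\mathrm{conj}(s_v)$ in $\mathrm{ST}_K(V,\psi)$ and $\mathrm{conj}(\tilde s_v)$ in $\widetilde{\mathrm{ST}_K}(V,\psi)$. The Sato--Tate Conjecture for $\mathrm{ST}_K(V,\psi)$ (resp. $\widetilde{\mathrm{ST}_K}(V,\psi)$) says that the classes $\mathrm{conj}(s_v)$ (resp. $\mathrm{conj}(\tilde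 s_v)$), with $v$ ordered by norm, are equidistributed in the space of conjugacy classes with respect to the measure induced by Haar measure. *)

(* Defs.v *)
From HB Require Import structures.
From mathcomp Require Import all_boot all_order all_algebra all_field.
From mathcomp Require Import finmap complex.
From mathcomp Require Import all_classical all_reals all_analysis.
From mathcomp Require mpoly.

Set Implicit Arguments.
Unset Strict Implicit.
Unset Printing Implicit Defensive.

Import Order.TTheory GRing.Theory Num.Theory.
Import numFieldNormedType.Exports.

Local Open Scope classical_set_scope.
Local Open Scope ring_scope.

(* The ascription makes the norm topology of numClosedFieldType available. *)
Definition Cpx (R : realType) : numClosedFieldType := R[i].

Definition RtoC (R : realType) (x : R) : Cpx R := (x%:C)%C.

(* ------------------------------------------------------------------ *)
(** * The absolute Galois group

    K is a number field embedded by iota in algC, which serves as its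
    algebraic closure.  Subfields of algC are represented by sets, elements
    of the Galois group by functions algC -> algC, products by \o. *)

Definition field_aut (g : algC -> algC) : Prop :=
  [/\ zmod_morphism g, monoid_morphism g & bijective g].

Definition gal (L : set algC) : set (algC -> algC) :=
  [set g | field_aut g /\ forall x, L x -> g x = x].

Section NumberField.
Variables (K : fieldExtType rat) (iota : {rmorphism K -> algC}).

Definition baseK : set algC := range iota.

Definition finite_ext (L : set algC) : Prop :=
  [/\ baseK `<=` L,
      forall x y, L x -> L y -> L (x - y),
      forall x y, L x -> L y -> L (x / y)
    & exists b : seq algC, forall x, L x ->
        exists a : 'I_(size b) -> K, x = \sum_i iota (a i) * b`_i].

Definition G_K : set (algC -> algC) := gal baseK.

Definition O_K : set K := [set x | iota x \in Aint].

Definition prime_place (v : set K) : Prop :=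
  [/\ v `<=` O_K,
      v 0 /\ (forall x y, v x -> v y -> v (x + y)),
      forall a x, O_K a -> v x -> v (a * x),
      ~ v 1 /\ (forall x y, O_K x -> O_K y -> v (x * y) -> v x \/ v y)
    & exists2 x, v x & x != 0].

Definition place_norm (v : set K) : nat :=
  #|` fset_set [set C | exists2 x, O_K x & C = [set y | O_K y /\ v (y - x)]]|.

(* M is a prime of the integral closure of O_K in algC lying over v. *)
Definition place_above (v : set K) (M : set algC) : Prop :=
  [/\ forall x, M x -> x \in Aint,
      forall x y, M x -> M y -> M (x + y),
      forall a x, a \in Aint -> M x -> M (a * x),
      ~ M 1 /\ (forall x y, x \in Aint -> y \in Aint ->
                  M (x * y) -> M x \/ M y)
    & forall x : K, M (iota x) <-> v x].

Definition in_inertia (v : set K) (g : algC -> algC) : Prop :=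
  G_K g /\ exists2 M, place_above v M
    & forall x, x \in Aint -> M (g x - x).

Definition is_frobenius (v : set K) (g : algC -> algC) : Prop :=
  G_K g /\ exists2 M, place_above v M
    & forall x, x \in Aint -> M (g x - x ^+ place_norm v).

End NumberField.

(* ------------------------------------------------------------------ *)
(** * l-adic fields *)

Section Valued.
Variables (R : realType) (F : fieldType) (abs : F -> R).

Definition nonarch_abs : Prop :=
  [/\ forall x, 0 <= abs x,
      forall x, abs x = 0 <-> x = 0,
      forall x y, abs (x * y) = abs x * abs y
    & forall x y, abs (x + y) <= Num.max (abs x) (abs y)].

Definition abs_complete : Prop :=
  forall u : nat -> F,
    (forall e, 0 < e -> exists N, forall p q,
       (N <= p)%N -> (N <= q)%N -> abs (u p - u q) < e) ->
    exists a, forall e, 0 < e -> exists N, forall p,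
       (N <= p)%N -> abs (u p - a) < e.

Definition abs_dense (S : set F) : Prop :=
  forall x e, 0 < e -> exists2 y, S y & abs (x - y) < e.

End Valued.

Definition primeT := {l : nat | prime l}.

(* Q_l, as the completion of rat with respect to the l-adic absolute value;
   this determines it up to a unique isomorphism. *)
Record Ql (R : realType) (l : primeT) := MkQl {
  Ql_field :> fieldType;
  Ql_inc : {rmorphism rat -> Ql_field};
  Ql_abs : Ql_field -> R;
  Ql_nonarch : nonarch_abs Ql_abs;
  Ql_norm : Ql_abs (val l)%:R = (val l)%:R^-1;
  Ql_compl : abs_complete Ql_abs;
  Ql_dense : abs_dense Ql_abs (range Ql_inc)
}.

(* C_l, as the completion of the algebraic closure of K at a place above l,
   together with the embedding of Q_l.  The place, hence its restriction
   lambda to K, is the one induced by Cl_inc. *)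
Record Cl (R : realType) (l : primeT) (Q : Ql R l) := MkCl {
  Cl_field :> fieldType;
  Cl_inc : {rmorphism algC -> Cl_field};
  Cl_Ql : {rmorphism Q -> Cl_field};
  Cl_abs : Cl_field -> R;
  Cl_nonarch : nonarch_abs Cl_abs;
  Cl_ext : forall x, Cl_abs (Cl_Ql x) = Ql_abs x;
  Cl_compl : abs_complete Cl_abs;
  Cl_dense : abs_dense Cl_abs (range Cl_inc)
}.

Arguments Ql_inc {R l} _.
Arguments Cl_inc {R l Q} _.
Arguments Cl_Ql {R l Q} _.

(* g lies in the decomposition group of the place of algC defining Cl, and
   tau is its action on Cl (the continuous extension of g). *)
Definition decomp_action (R : realType) (l : primeT) (Q : Ql R l)
    (C : Cl Q) (g : algC -> algC) (tau : C -> C) : Prop :=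
  (forall x y, Cl_abs (tau x - tau y) = Cl_abs (x - y)) /\
  (forall x, tau (Cl_inc C x) = Cl_inc C (g x)).

(* chi is the l-adic cyclotomic character of G. *)
Definition cyclotomic_char (R : realType) (l : primeT) (Q : Ql R l)
    (G : set (algC -> algC)) (chi : (algC -> algC) -> Q) : Prop :=
  forall g (k a : nat) z, G g -> (val l ^ k)%N.-primitive_root z ->
    g z = z ^+ a -> Ql_abs (chi g - a%:R) <= (val l)%:R ^- k.

(* ------------------------------------------------------------------ *)
(** * Hodge structures and de Rham data

    V is Q^d with its column vectors, the form psi is given by its Gram
    matrix Psi (with respect to the generator (2 i pi)^-n of Q(-n)). *)

Section BaseChange.
Variables (F E : fieldType) (f : F -> E) (d : nat).

Definition base_change (U : {vspace 'cV[F]_d}) : {vspace 'cV[E]_d} :=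
  <<[seq map_mx f u | u <- vbasis U]>>%VS.

End BaseChange.

(* The family U is a direct sum decomposition of the whole space. *)
Definition decomposition (F : fieldType) (W : vectType F)
    (U : int -> {vspace W}) : Prop :=
  exists s : seq int,
    [/\ uniq s, forall i, i \notin s -> U i = 0%VS,
        directv (\sum_(i <- s) U i)%VS
      & (\sum_(i <- s) U i)%VS = fullv].

Section Hodge.
Variables (R : realType) (d : nat) (n : int) (Psi : 'M[rat]_d).
(* H p is V^(p, n - p) *)
Variable H : int -> {vspace 'cV[Cpx R]_d}.

Definition PsiC : 'M[Cpx R]_d := map_mx ratr Psi.

Definition hodge_structure : Prop :=
  decomposition H /\
  forall p (v : 'cV[Cpx R]_d),
    v \in H p -> map_mx Num.conj v \in H (n - p).

Definition polarization : Prop :=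
  [/\ Psi^T = (-1) ^ n *: Psi,
      forall p q (v w : 'cV[Cpx R]_d), p + q != n ->
        v \in H p -> w \in H q -> v^T *m PsiC *m w = 0
    & forall p (v : 'cV[Cpx R]_d), v \in H p -> v != 0 ->
        0 < 'i ^ (p - (n - p)) * (v^T *m PsiC *m map_mx Num.conj v) 0 0].

Definition in_hodge_fil (p : int) (v : 'cV[Cpx R]_d) : Prop :=
  exists s : seq int, all (fun i => p <= i) s /\ v \in (\sum_(i <- s) H i)%VS.

Definition two_i_pi : Cpx R := 2%:R * 'i * RtoC pi.

Section DeRham.
Variable K : fieldExtType rat.
(* V_DR is K^d: the comparison isomorphisms force dim V_DR = dim V. *)
Variable PsiDR : 'M[K]_d.
Variable Fil : int -> {vspace 'cV[K]_d}.
Variable cmp : {rmorphism K -> Cpx R} -> 'M[Cpx R]_d.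

(* The factor is the comparison between Q(-n) and K(-n). *)
Definition de_rham_data : Prop :=
  [/\ PsiDR \in unitmx,
      forall i, (Fil (i + 1) <= Fil i)%VS
    & forall s, [/\ cmp s \in unitmx,
        (cmp s)^T *m map_mx s PsiDR *m cmp s = two_i_pi ^ (- n) *: PsiC
      & forall p v, in_hodge_fil p v <-> cmp s *m v \in base_change s (Fil p)]].

(* The summand of V_C corresponding to G^i V_DR (x)_(K,s) C under the
   comparison isomorphism: F^i meets the conjugate of F^(n-i). *)
Definition dr_summand (s : {rmorphism K -> Cpx R}) (i : int) :
    set 'cV[Cpx R]_d :=
  [set v | cmp s *m v \in base_change s (Fil i) /\
           cmp s *m map_mx Num.conj v \in base_change s (Fil (n - i))].

Variable iota : {rmorphism K -> algC}.
Variable D : set 'M[rat]_d.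
Variable rhoe : (algC -> algC) -> 'M[rat]_d -> 'M[rat]_d.
Variable rDR : 'M[rat]_d -> 'M[algC]_d.

Definition D1 : Prop :=
  [/\ D 1%:M /\ (forall x y, D x -> D y -> D (x - y)),
      forall x y, D x -> D y -> D (x *m y)
    & forall x p (v : 'cV[Cpx R]_d),
        D x -> v \in H p -> map_mx ratr x *m v \in H p].

Definition D2 : Prop :=
  [/\ forall g x, G_K iota g -> D x -> D (rhoe g x),
      forall g x y, G_K iota g -> D x -> D y ->
        rhoe g (x + y) = rhoe g x + rhoe g y,
      forall x, D x -> rhoe id x = x,
      forall g h x, G_K iota g -> G_K iota h -> D x ->
        rhoe (g \o h) x = rhoe g (rhoe h x)
    & forall x, D x -> exists2 L, finite_ext iota L &
        forall g, gal L g -> rhoe g x = x].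

Definition DR1 : Prop :=
  [/\ rDR 1%:M = 1%:M,
      forall x y, D x -> D y -> rDR (x + y) = rDR x + rDR y,
      forall x y, D x -> D y -> rDR (x *m y) = rDR x *m rDR y,
      forall x y, D x -> D y -> rDR x = rDR y -> x = y
    & forall s : {rmorphism K -> Cpx R},
        exists2 sbar : {rmorphism algC -> Cpx R},
          (forall a, sbar (iota a) = s a)
        & forall x, D x ->
            cmp s *m map_mx ratr x = map_mx sbar (rDR x) *m cmp s].

Definition DR2 : Prop :=
  forall x s i v, D x -> dr_summand s i v ->
    dr_summand s i (map_mx ratr x *m v).

End DeRham.
End Hodge.

(* ------------------------------------------------------------------ *)
(** * Systems of l-adic representations *)

Section Representations.
Variables (R : realType) (K : fieldExtType rat).
Variables (iota : {rmorphism K -> algC}) (d : nat) (n : int).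
Variables (Psi : 'M[rat]_d) (Fil : int -> {vspace 'cV[K]_d}).
Variables (D : set 'M[rat]_d).
Variables (rhoe : (algC -> algC) -> 'M[rat]_d -> 'M[rat]_d).
Variables (rDR : 'M[rat]_d -> 'M[algC]_d).

Section OnePrime.
Variables (l : primeT) (Q : Ql R l).
Variables (chi : (algC -> algC) -> Q) (rho : (algC -> algC) -> 'M[Q]_d).

Definition PsiQl : 'M[Q]_d := map_mx (Ql_inc Q) Psi.

Definition ladic_rep : Prop :=
  [/\ forall g, G_K iota g -> rho g \in unitmx,
      forall g h, G_K iota g -> G_K iota h ->
        rho (g \o h) = rho g *m rho h,
      forall g e, G_K iota g -> 0 < e ->
        exists2 L, finite_ext iota L &
          forall h, G_K iota h -> (forall x, L x -> h x = g x) ->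
            forall i j, Ql_abs (rho h i j - rho g i j) < e
    & forall g, G_K iota g ->
        (rho g)^T *m PsiQl *m rho g = chi g ^ (- n) *: PsiQl].

Definition unramified (v : set K) : Prop :=
  forall g, in_inertia iota v g -> rho g = 1%:M.

(* V_l (x) C_l has a basis on which the decomposition group acts
   through powers of chi. *)
Definition hodge_tate_type : Prop :=
  forall C : Cl Q, exists (m : 'I_d -> int) (P : 'M[C]_d),
    P \in unitmx /\
    forall g tau, G_K iota g -> decomp_action g tau ->
      map_mx (Cl_Ql C) (rho g) *m map_mx tau P =
      P *m diag_mx (\row_j Cl_Ql C (chi g ^ m j)).

Definition frob_abs (v : set K) : Prop :=
  forall g (e : {rmorphism Q -> Cpx R}) z,
    is_frobenius iota v g -> root (map_poly e (char_poly (rho g))) z ->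
    `|z| = RtoC (Num.sqrt (place_norm iota v)%:R ^ (- n)).

Definition R2 : Prop :=
  exists2 S : set (set K), finite_set S &
    [/\ forall v, prime_place iota v -> v (val l)%:R -> S v
      & forall v, prime_place iota v -> ~ S v -> frob_abs v].

(* T i is the C_l-linear map F^i V_DR (x) C_l -> V_l (x) C_l with kernel
   F^(i+1) V_DR (x) C_l which induces the embedding of
   G^i V_DR (x) C_l(i - n) as a direct summand. *)
Definition R3_R4 : Prop :=
  (forall C : Cl Q,
    let FilC i := base_change (Cl_inc C \o iota) (Fil i) in
    exists T : int -> 'M[C]_d,
      [/\ forall i (x : 'cV[C]_d), x \in FilC i ->
            (T i *m x = 0 <-> x \in FilC (i + 1)),
          decomposition
            (fun i => (linfun (mulmx (T i)) @: FilC i)%VS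
                      : {vspace 'cV[C]_d}),
          forall i g tau (x : 'cV[C]_d),
            G_K iota g -> decomp_action g tau -> x \in FilC i ->
            map_mx (Cl_Ql C) (rho g) *m map_mx tau (T i *m x) =
            T i *m (Cl_Ql C (chi g ^ (i - n)) *: map_mx tau x)
        & forall b i (x : 'cV[C]_d), D b -> x \in FilC i ->
            map_mx (Cl_Ql C \o Ql_inc Q) b *m (T i *m x) =
            T i *m (map_mx (Cl_inc C) (rDR b) *m x)]) /\
  (forall g b, G_K iota g -> D b ->
     rho g *m map_mx (Ql_inc Q) b = map_mx (Ql_inc Q) (rhoe g b) *m rho g).

(* The representation on W_l, the direct sum of V_l and Q_l(1). *)
Definition rho_tilde (g : algC -> algC) : 'M[Q]_(d + 1) :=
  block_mx (rho g) 0 0 (chi g)%:M.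

End OnePrime.

Section AllPrimes.
Variables (Q : forall l : primeT, Ql R l).
Variables (chi : forall l, (algC -> algC) -> Q l).
Variables (rho : forall l, (algC -> algC) -> 'M[Q l]_d).

Definition strictly_compatible : Prop :=
  exists2 S : set (set K), finite_set S &
    forall v, prime_place iota v -> ~ S v ->
      exists P : {poly rat}, forall l : primeT, ~ v (val l)%:R ->
        unramified (@rho l) v /\
        forall g, is_frobenius iota v g ->
          char_poly (rho l g) = map_poly (Ql_inc (Q l)) P.

Definition R1 : Prop :=
  strictly_compatible /\ forall l, hodge_tate_type (@chi l) (@rho l).

Definition compatible_system : Prop :=
  [/\ forall l, cyclotomic_char (G_K iota) (@chi l),
      forall l, ladic_rep (@chi l) (@rho l),
      R1,
      forall l, R2 (@rho l)
    & forall l, R3_R4 (@chi l) (@rho l)].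

End AllPrimes.
End Representations.

(* ------------------------------------------------------------------ *)
(** * Linear algebraic groups

    A closed subscheme of GL_d over k is given by a set of polynomials in
    the matrix entries and handled through its points in k-algebras. *)

Section AlgebraicGroups.
Variable k : fieldType.

Definition subfunctor (d : nat) :=
  forall A : comUnitRingType, {rmorphism k -> A} -> set 'M[A]_d.

Definition entries_eval (d : nat) (A : comUnitRingType) (f : k -> A)
    (x : 'M[A]_d) (P : mpoly.mpoly (d * d) k) : A :=
  mpoly.mmap f (fun i => mxvec x 0 i) P.

Definition zeros (d : nat) (I : set (mpoly.mpoly (d * d) k)) :
    subfunctor d :=
  fun A f => [set x | x \in unitmx /\ forall P, I P -> entries_eval f x P = 0].

Definition matrix_group (d : nat) (A : comUnitRingType)
    (G : set 'M[A]_d) : Prop :=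
  [/\ forall x, G x -> x \in unitmx, G 1%:M,
      forall x y, G x -> G y -> G (x *m y)
    & forall x, G x -> G (invmx x)].

Definition algebraic_group (d : nat) (G : subfunctor d) : Prop :=
  (exists I, G = zeros I) /\ forall A f, matrix_group (G A f).

(* The Zariski closure in GL_d of a set of k-points. *)
Definition zariski_closure (d : nat) (X : set 'M[k]_d) : subfunctor d :=
  zeros [set P | forall x, X x -> entries_eval id x P = 0].

Definition map_functor (d e : nat) :=
  forall A : comUnitRingType, {rmorphism k -> A} -> 'M[A]_d -> 'M[A]_e.

Definition group_hom (d e : nat) (G : subfunctor d) (H : subfunctor e)
    (phi : map_functor d e) : Prop :=
  [/\ forall A f x, G A f x -> H A f (phi A f x),
      forall A f x y, G A f x -> G A f y ->
        phi A f (x *m y) = phi A f x *m phi A f y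
    & forall (A B : comUnitRingType) (f : {rmorphism k -> A})
             (g : {rmorphism k -> B}) (u : {rmorphism A -> B}),
        (forall a, u (f a) = g a) ->
        forall x, G A f x -> phi B g (map_mx u x) = map_mx u (phi A f x)].

Definition group_mono (d e : nat) (G : subfunctor d) (H : subfunctor e)
    (phi : map_functor d e) : Prop :=
  group_hom G H phi /\ forall A f, {in G A f &, injective (phi A f)}.

Definition group_iso (d e : nat) (G : subfunctor d) (H : subfunctor e)
    (phi : map_functor d e) : Prop :=
  group_hom G H phi /\ forall A f, set_bij (G A f) (H A f) (phi A f).

End AlgebraicGroups.

Definition subfunctor_bc (k k' : fieldType) (i : {rmorphism k -> k'})
    (d : nat) (G : subfunctor k d) : subfunctor k' d :=
  fun A f => G A (f \o i).

Section Reductive.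
Variable d : nat.

Definition closed_in_GL (U : set 'M[algC]_d) : Prop :=
  exists I : set (mpoly.mpoly (d * d) algC), U = zeros I idfun.

Definition zariski_connected (U : set 'M[algC]_d) : Prop :=
  forall Z1 Z2, closed_in_GL Z1 -> closed_in_GL Z2 ->
    U `<=` Z1 `|` Z2 -> U `&` Z1 `&` Z2 = set0 -> U `<=` Z1 \/ U `<=` Z2.

(* Not necessarily connected reductive groups over rat: the unipotent
   radical over the algebraic closure is trivial. *)
Definition reductive (G : subfunctor rat d) : Prop :=
  algebraic_group G /\
  forall U : set 'M[algC]_d,
    closed_in_GL U -> matrix_group U -> zariski_connected U ->
    U `<=` G algC ratr ->
    (forall x u, G algC ratr x -> U u -> U (x *m u *m invmx x)) ->
    (forall u, U u -> (u - 1%:M) ^+ d = 0) ->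
    U = [set 1%:M].

End Reductive.

(* The group Iso_(V, psi), over any field over which psi is defined. *)
Definition Iso (k : fieldType) (d : nat) (Psi : 'M[k]_d) : subfunctor k d :=
  fun A f => [set x | x \in unitmx /\
                      x^T *m map_mx f Psi *m x = map_mx f Psi].

(* ------------------------------------------------------------------ *)
(** * The algebraic Sato--Tate conjecture *)

Section AlgebraicSatoTate.
Variables (R : realType) (K : fieldExtType rat).
Variables (iota : {rmorphism K -> algC}) (d : nat) (Psi : 'M[rat]_d).
Variables (Q : forall l : primeT, Ql R l).
Variables (chi : forall l, (algC -> algC) -> Q l).
Variables (rho : forall l, (algC -> algC) -> 'M[Q l]_d).

Definition Gt_alg (l : primeT) (L : set algC) : subfunctor (Q l) (d + 1) :=
  zariski_closure [set rho_tilde (@chi l) (@rho l) g | g in gal L].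

(* N is the lower right entry of a block diagonal matrix. *)
Arguments Gt_alg : clear implicits.

Definition Gt1_alg (l : primeT) (L : set algC) : subfunctor (Q l) (d + 1) :=
  fun A f => [set x | Gt_alg l L A f x /\ drsubmx x = 1%:M].

Arguments Gt1_alg : clear implicits.

Variable ASTt : set algC -> subfunctor rat d.
Variable ast : forall (l : primeT) (L : set algC), map_functor (Q l) (d + 1) d.
(* res L L' : AST~_L' -> AST~_L for L contained in L' *)
Variable res : forall L L' : set algC, map_functor rat d d.

Arguments ASTt : clear implicits.
Arguments ast : clear implicits.
Arguments res : clear implicits.

Definition algebraic_sato_tate : Prop :=
  [/\ forall L, finite_ext iota L ->
        reductive (ASTt L) /\ forall A f, ASTt L A f `<=` Iso Psi f,
      forall l L, finite_ext iota L ->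
        group_iso (Gt1_alg l L) (subfunctor_bc (Ql_inc (Q l)) (ASTt L))
          (ast l L)
        /\ forall A f x, Gt1_alg l L A f x -> ast l L A f x = ulsubmx x,
      forall L L', finite_ext iota L -> finite_ext iota L' -> L `<=` L' ->
        group_mono (ASTt L') (ASTt L) (res L L'),
      (forall L A f x, finite_ext iota L -> ASTt L A f x ->
         res L L A f x = x) /\
      (forall L L' L'' A f x,
         finite_ext iota L -> finite_ext iota L' -> finite_ext iota L'' ->
         L `<=` L' -> L' `<=` L'' -> ASTt L'' A f x ->
         res L L'' A f x = res L L' A f (res L' L'' A f x))
    & forall l L L' (A : comUnitRingType) (f : {rmorphism Q l -> A}) x,
        finite_ext iota L -> finite_ext iota L' -> L `<=` L' ->
        Gt1_alg l L' A f x ->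
        res L L' A (f \o Ql_inc (Q l)) (ast l L' A f x) = ast l L A f x].

End AlgebraicSatoTate.

(* ------------------------------------------------------------------ *)
(** * Sato--Tate groups and the Sato--Tate conjecture *)

Section SatoTate.
Variables (R : realType) (d : nat).
Implicit Types G H : set 'M[Cpx R]_d.

Definition pm G : set 'M[Cpx R]_d := G `|` [set - x | x in G].

Definition maximal_compact G H : Prop :=
  [/\ matrix_group H, H `<=` G, compact H
    & forall H', matrix_group H' -> H' `<=` G -> compact H' ->
        H `<=` H' -> H' = H].

Definition lcoset H (x : 'M[Cpx R]_d) : set 'M[Cpx R]_d :=
  [set x *m h | h in H].

Definition cosets G H : set (set 'M[Cpx R]_d) := [set lcoset H x | x in G].

(* The map G / H -> G' / H' induced by the inclusion of G in G'. *)
Definition coset_map H' (C : set 'M[Cpx R]_d) : set 'M[Cpx R]_d :=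
  \bigcup_(x in C) lcoset H' x.

Definition conj_class G (x : 'M[Cpx R]_d) : set 'M[Cpx R]_d :=
  [set h *m x *m invmx h | h in G].

(* s is the semisimple part in the multiplicative Jordan decomposition. *)
Definition ss_part (m : nat) (g s : 'M[Cpx R]_m) : Prop :=
  diagonalizable s /\ exists u,
    [/\ (u - 1%:M) ^+ m = 0, s *m u = u *m s & g = s *m u].

Definition borelM := g_sigma_algebraType (@open 'M[Cpx R]_d).

Definition haar G (mu : {measure set borelM -> \bar R}) : Prop :=
  [/\ mu G = 1%E, mu (~` G) = 0%E
    & forall g (A : set borelM), G g -> measurable A -> A `<=` G ->
        mu [set g *m x | x in A] = mu A].

(* A function phi on the space of conjugacy classes of G, which has the
   quotient topology and the image of the Haar measure, is handled through
   the class function x |-> phi (conj_class G x).  The family cls is indexed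
   by the places in the set good, ordered by nm. *)
Definition equidistributed (I : choiceType) G (good : set I) (nm : I -> nat)
    (cls : I -> set 'M[Cpx R]_d) (mu : {measure set borelM -> \bar R}) : Prop :=
  forall phi : set 'M[Cpx R]_d -> R,
    {within G, continuous (fun x => phi (conj_class G x))} ->
    let upto N := [set v | good v /\ (nm v <= N)%N] in
    (fun N : nat => (\sum_(v \in upto N) phi (cls v)) / #|` fset_set (upto N)|%:R)
      @ \oo --> \int[mu]_(x in G) phi (conj_class G x).

End SatoTate.

Section SatoTateConjecture.
Variables (R : realType) (K : fieldExtType rat).
Variables (iota : {rmorphism K -> algC}) (d : nat) (n : int).
Variables (l : primeT) (Q : Ql R l) (emb : {rmorphism Q -> Cpx R}).
Variables (chi : (algC -> algC) -> Q) (rho : (algC -> algC) -> 'M[Q]_d).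

(* v is not excluded: it is prime to l, rho is unramified at v and the
   Frobenius eigenvalues at v have absolute value q_v^(-n/2). *)
Definition good_place (v : set K) : Prop :=
  [/\ prime_place iota v, ~ v (val l)%:R, unramified iota rho v
    & frob_abs iota n rho v].

Variables (E : set (set K)) (Fr : set K -> algC -> algC).

Definition qhalf (v : set K) (m : int) : Cpx R :=
  RtoC (Num.sqrt (place_norm iota v)%:R ^ m).

Definition norm_frob (v : set K) : 'M[Cpx R]_d :=
  qhalf v n *: map_mx emb (rho (Fr v)).

Definition norm_frob_tilde (v : set K) : 'M[Cpx R]_(d + 1) :=
  block_mx (qhalf v n)%:M 0 0 (qhalf v (- 2))%:M *m
  map_mx emb (rho_tilde chi rho (Fr v)).

(* The conjugacy class in ST determined by the semisimple part of the
   normalized Frobenius, which lies in AST. *)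
Definition frob_class (AST ST : set 'M[Cpx R]_d) (v : set K) :
    set 'M[Cpx R]_d :=
  [set x | ST x /\ exists2 s, ss_part (norm_frob v) s & conj_class AST s x].

(* ast identifies the group containing s~_v with ASTt. *)
Definition frob_class_tilde (ast : 'M[Cpx R]_(d + 1) -> 'M[Cpx R]_d)
    (ASTt STt : set 'M[Cpx R]_d) (v : set K) : set 'M[Cpx R]_d :=
  [set x | STt x /\
     exists2 s, ss_part (norm_frob_tilde v) s & conj_class ASTt (ast s) x].

(* By existence and uniqueness of the normalized Haar measure of a compact
   group, it does not matter how mu is quantified. *)
Definition sato_tate (G : set 'M[Cpx R]_d) (cls : set K -> set 'M[Cpx R]_d) :
    Prop :=
  exists2 mu, haar G mu &
    equidistributed G [set v | prime_place iota v /\ ~ E v]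
      (place_norm iota) cls mu.

End SatoTateConjecture.

(* Main.v *)
(** Frobenius at v acts on the roots of unity of l-power order by z |-> z^q, so the
   cyclotomic character takes the value q = q_v on it.  A polynomial which vanishes
   on the powers rho~(Fr)^k, written in terms of the Jordan decomposition, is an
   exponential polynomial in k which is identically zero; by linear independence of
   the sequences mu^k k^j it still vanishes when every eigenvalue mu is replaced by
   mu / |mu|.  As the eigenvalues have absolute values q^(-n/2) and q, this says
   that the semisimple part of the normalized Frobenius lies in AST~.

   Hence, if -1 is not in AST~, all Frobenius classes of ST lie in the open and
   closed subgroup ST~ of index 2, which has Haar measure 1/2: they cannot be
   equidistributed.  If -1 is in AST~, the two groups and the two families of
   classes coincide; for the latter one needs that the semisimple part of a block
   diagonal matrix is block diagonal, which is again the linear independence of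
   exponential polynomials.  Finally -1 is in AST~ if and only if it is in ST~,
   because ST~ is a maximal compact subgroup. *)

Require Import Defs.
From HB Require Import structures.
From mathcomp Require Import all_boot all_order all_algebra all_field.
From mathcomp Require Import finmap complex.
From mathcomp Require Import all_classical all_reals all_analysis.
From mathcomp Require Import lra.

Set Implicit Arguments.
Unset Strict Implicit.
Unset Printing Implicit Defensive.

Import Order.TTheory GRing.Theory Num.Theory.
Import numFieldNormedType.Exports.

Local Open Scope classical_set_scope.
Local Open Scope ring_scope.

(** * Linear independence of the sequences mu^k k^j *)

Section ExponentialPolynomials.
Variable F : numFieldType.
Implicit Types (p q : {poly F}) (mu : F) (s : seq (F * {poly F})).

(** In characteristic 0 the first [size p] natural numbers are distinct, which is one root too many
    for a nonzero [p]. *)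
Lemma poly_nat_eq0 p : (forall k : nat, p.[k%:R] = 0) -> p = 0.
Proof.
move=> p0; apply/eqP; apply: contraT => p_neq0.
have := @max_poly_roots _ p [seq k%:R | k <- iota 0 (size p)] p_neq0.
rewrite size_map size_iota ltnn; apply.
  by apply/allP => _ /mapP[k _ ->]; apply/rootP.
by rewrite map_inj_uniq ?iota_uniq // => i j /eqP; rewrite eqr_nat => /eqP.
Qed.

Definition shift_poly p := p \Po ('X + 1%:P).

Lemma horner_shift_poly p x : (shift_poly p).[x] = p.[x + 1].
Proof. by rewrite horner_comp !hornerE. Qed.

Lemma size_shift_poly p : size (shift_poly p) = size p.
Proof. by rewrite size_comp_poly2 // size_XaddC. Qed.

Lemma lead_coef_shift_poly p : lead_coef (shift_poly p) = lead_coef p.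
Proof.
by rewrite lead_coef_comp ?size_XaddC // lead_coefXaddC expr1n mulr1.
Qed.

Lemma last_coef_shift_poly p : (shift_poly p)`_(size p).-1 = lead_coef p.
Proof. by rewrite -lead_coef_shift_poly lead_coefE size_shift_poly. Qed.

Lemma size_shift_polyB n p :
  (size p <= n.+1)%N -> (size (shift_poly p - p)%R <= n)%N.
Proof.
move=> pn; have [->|p0] := eqVneq p 0.
  by rewrite /shift_poly comp_poly0 subrr size_poly0.
apply: leq_trans (_ : (size p).-1 <= n)%N; last by case: (size p) pn.
apply/leq_sizeP => j; rewrite leq_eqVlt => /orP[/eqP<-|jn].
  by rewrite coefB last_coef_shift_poly subrr.
have pj : (size p <= j)%N by case: (size p) jn.
by rewrite coefB !nth_default ?subrr // size_shift_poly.
Qed.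

(** A shift preserves the leading coefficient, so the top coefficient of the combination is
    [(a - b) * lead_coef p]. *)
Lemma scaled_shift_eq0 (a b : F) p :
  a != b -> a *: shift_poly p - b *: p = 0 -> p = 0.
Proof.
move=> ab /(congr1 (fun q : {poly F} => q`_(size p).-1)).
rewrite coefB !coefZ coef0 last_coef_shift_poly -mulrBl => /eqP.
by rewrite mulf_eq0 subr_eq0 (negPf ab) lead_coef_eq0 /= => /eqP.
Qed.

(* With E the shift of sequences, E - mu0 lowers the degree of the polynomial factor
   of mu0^k and keeps that of the other mu^k nonzero. *)
Lemma exp_poly_free (mus : seq F) (p : F -> {poly F}) :
  uniq mus -> 0 \notin mus ->
  (forall k : nat, \sum_(mu <- mus) mu ^+ k * (p mu).[k%:R] = 0) ->
  {in mus, forall mu, p mu = 0}.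
Proof.
elim: mus p => [|mu0 mus IH] p //= /andP[mu0_mus mus_uniq].
rewrite inE negb_or eq_sym => /andP[mu0_neq0 mus_neq0].
(* The inner induction is on the size of [p mu0]; the outer one, on [mus], takes over once [p mu0]
   vanishes. *)
have [n] := ubnP (size (p mu0)); elim: n p => // n IHn p pn p_sum.
have [p0|p_neq0] := eqVneq (p mu0) 0.
  move=> mu; rewrite inE => /orP[/eqP->//|].
  apply: IH => // k; have := p_sum k.
  by rewrite big_cons p0 horner0 mulr0 add0r.
have mus_p : {in mus, forall mu, p mu = 0}.
  pose q mu := mu *: shift_poly (p mu) - mu0 *: p mu.
  have q0 : {in mu0 :: mus, forall mu, q mu = 0}.
    apply: IHn.
      rewrite /q -scalerBr (leq_ltn_trans (size_scale_leq _ _)) //.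
      case En: (size (p mu0)) pn => [|m] mn.
        by move/eqP: En p_neq0; rewrite size_poly_eq0 => ->.
      by apply: leq_ltn_trans (mn : (m < n)%N); rewrite size_shift_polyB ?En.
    move=> k; transitivity (\sum_(mu <- mu0 :: mus) mu ^+ k.+1 * (p mu).[k.+1%:R]
        - mu0 * (\sum_(mu <- mu0 :: mus) mu ^+ k * (p mu).[k%:R])); last first.
      by rewrite !p_sum mulr0 subrr.
    rewrite mulr_sumr -sumrB; apply: eq_bigr => mu _.
    rewrite /q hornerD hornerN !hornerZ horner_shift_poly -natr1 exprS mulrBr.
    by rewrite !mulrA; congr (_ - _); [rewrite (mulrC mu)|rewrite (mulrC mu0)].
  move=> mu mu_mus; apply: (@scaled_shift_eq0 mu mu0).
    by apply: contraNneq mu0_mus => <-.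
  by apply: q0; rewrite inE mu_mus orbT.
suff p0 : p mu0 = 0 by rewrite p0 eqxx in p_neq0.
apply: poly_nat_eq0 => k; have := p_sum k.
rewrite big_cons big1_seq ?addr0 => [/eqP|mu /andP[_ mu_mus]].
  by rewrite mulf_eq0 expf_eq0 (negPf mu0_neq0) andbF => /eqP.
by rewrite mus_p // horner0 mulr0.
Qed.

(** * Twisting exponential polynomials by a multiplicative map, later z / |z| or the identity *)

Section Twist.
Variable phi : F -> F.
Hypotheses (phi1 : phi 1 = 1) (phiM : {morph phi : x y / x * y}).

(* [f] is an exponential polynomial and [a] is obtained from it by putting k = 0 in
   the polynomial factors and replacing each mu ^+ k by phi mu. *)
Definition twisted_value (f : nat -> F) (a : F) : Prop :=
  exists s, [/\ all (fun t => t.1 != 0) s,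
    forall k, f k = \sum_(t <- s) t.1 ^+ k * t.2.[k%:R]
  & a = \sum_(t <- s) phi t.1 * t.2.[0]].

Lemma twisted_value_poly p : twisted_value (fun k => p.[k%:R]) p.[0].
Proof.
exists [:: (1, p)]; split=> [|k|] /=; first by rewrite oner_eq0.
  by rewrite big_seq1 expr1n mul1r.
by rewrite big_seq1 phi1 mul1r.
Qed.

Lemma twisted_value_cst a : twisted_value (fun=> a) a.
Proof.
have := twisted_value_poly a%:P; rewrite hornerC => -[s [s0 sk s1]].
by exists s; split=> // k; rewrite -sk hornerC.
Qed.

Lemma twisted_value_exp mu : mu != 0 -> twisted_value (GRing.exp mu) (phi mu).
Proof.
move=> mu0; exists [:: (mu, 1)]; split=> [|k|] /=; first by rewrite mu0.
  by rewrite big_seq1 hornerC mulr1.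
by rewrite big_seq1 hornerC mulr1.
Qed.

Lemma twisted_value_ext f g a : f =1 g -> twisted_value f a -> twisted_value g a.
Proof. by move=> fg [s [s0 sk s1]]; exists s; split=> // k; rewrite -fg. Qed.

Lemma twisted_valueD f g a b : twisted_value f a -> twisted_value g b ->
  twisted_value (fun k => f k + g k) (a + b).
Proof.
move=> [s [s0 sk ->]] [t [t0 tk ->]]; exists (s ++ t); split=> [|k|].
- by rewrite all_cat s0.
- by rewrite big_cat sk tk.
- by rewrite big_cat.
Qed.

Lemma twisted_valueM f g a b : twisted_value f a -> twisted_value g b ->
  twisted_value (fun k => f k * g k) (a * b).
Proof.
move=> [s [s0 sk ->]] [t [t0 tk ->]].
exists [seq (x.1 * y.1, x.2 * y.2) | x <- s, y <- t]; split=> [|k|].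
- apply/allP => _ /allpairsP[[x y] [/= xs yt ->]] /=.
  by rewrite mulf_neq0 ?(allP s0 _ xs) ?(allP t0 _ yt).
- rewrite sk tk big_allpairs_dep mulr_suml; apply: eq_bigr => x _.
  rewrite mulr_sumr; apply: eq_bigr => y _ /=.
  by rewrite exprMn hornerM mulrACA.
- rewrite big_allpairs_dep mulr_suml; apply: eq_bigr => x _.
  rewrite mulr_sumr; apply: eq_bigr => y _ /=.
  by rewrite phiM hornerM mulrACA.
Qed.

Lemma twisted_value_sum (I : Type) (r : seq I) (f : I -> nat -> F) a :
  (forall i, twisted_value (f i) (a i)) ->
  twisted_value (fun k => \sum_(i <- r) f i k) (\sum_(i <- r) a i).
Proof.
move=> fa; elim: r => [|i r IH].
  by rewrite big_nil; apply: twisted_value_ext (twisted_value_cst 0) => k; rewrite big_nil.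
rewrite big_cons; apply: twisted_value_ext (twisted_valueD (fa i) IH) => k.
by rewrite big_cons.
Qed.

Lemma twisted_valueX f a m : twisted_value f a ->
  twisted_value (fun k => f k ^+ m) (a ^+ m).
Proof.
move=> fa; elim: m => [|m IH]; first exact: twisted_value_cst.
rewrite exprS; apply: twisted_value_ext (twisted_valueM fa IH) => k.
by rewrite exprS.
Qed.

Lemma twisted_value_prod (I : Type) (r : seq I) (f : I -> nat -> F) a :
  (forall i, twisted_value (f i) (a i)) ->
  twisted_value (fun k => \prod_(i <- r) f i k) (\prod_(i <- r) a i).
Proof.
move=> fa; elim: r => [|i r IH].
  by rewrite big_nil; apply: twisted_value_ext (twisted_value_cst 1) => k; rewrite big_nil.
rewrite big_cons; apply: twisted_value_ext (twisted_valueM (fa i) IH) => k.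
by rewrite big_cons.
Qed.

(** The same base may occur several times in [s]. After the polynomial factors are collected base by
    base, linear independence makes each collected factor zero, and with it the twisted sum. *)
Lemma twisted_value0 f a : (forall k, f k = 0) -> twisted_value f a -> a = 0.
Proof.
move=> f0 [s [s0 sk ->]].
pose p mu := \sum_(t <- s | t.1 == mu) t.2.
pose mus := undup [seq t.1 | t <- s].
have group (h : F -> F) (x : F) :
    \sum_(t <- s) h t.1 * t.2.[x] = \sum_(mu <- mus) h mu * (p mu).[x].
  under [RHS]eq_bigr => mu _.
    rewrite horner_sum mulr_sumr big_mkcond.
    over.
  rewrite exchange_big; apply: eq_big_seq => t ts /=.
  rewrite (bigD1_seq t.1) ?undup_uniq ?mem_undup ?map_f //= eqxx.
  by rewrite big1 ?addr0 // => mu /negPf; rewrite eq_sym => ->.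
have p0 : {in mus, forall mu, p mu = 0}.
  apply: exp_poly_free; first exact: undup_uniq.
    by rewrite mem_undup; apply/mapP => -[t /(allP s0)/eqP t0 /esym].
  by move=> k; rewrite -(group (fun mu => mu ^+ k)) -sk.
by rewrite group big1_seq // => mu /andP[_ /p0->]; rewrite horner0 mulr0.
Qed.

End Twist.
End ExponentialPolynomials.

(** * Powers of a matrix given by its Jordan decomposition *)

Section JordanDecomposition.
Variable F : numFieldType.

(** The binomial coefficient ['C(k, j)] as a polynomial in k; it makes the powers of a unipotent
    matrix polynomial in the exponent. *)
Definition bin_poly (j : nat) : {poly F} :=
  (j`!%:R)^-1 *: \prod_(i < j) ('X - i%:R%:P).

Lemma horner_bin_poly (j k : nat) : (bin_poly j).[k%:R] = 'C(k, j)%:R.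
Proof.
have fact_neq0 : j`!%:R != 0 :> F by rewrite pnatr_eq0 -lt0n fact_gt0.
apply: (mulfI fact_neq0); rewrite hornerZ mulVKf // horner_prod -natrM mulnC.
rewrite bin_ffact ffact_prod natr_prod.
have [jk|kj] := leqP j k.
  by apply: eq_bigr => i _; rewrite !hornerE natrB // (leq_trans (ltnW (ltn_ord i)) jk).
rewrite (bigD1 (Ordinal kj)) //= !hornerE subrr mul0r.
by rewrite (bigD1 (Ordinal kj)) //= subnn mul0r.
Qed.

Lemma unipotent_expr m (u : 'M[F]_m) k : (u - 1%:M) ^+ m = 0 ->
  u ^+ k = \sum_(a < m) (u - 1%:M) ^+ a *+ 'C(k, a).
Proof.
move=> uN; rewrite -{1}(subrK 1%:M u) exprD1n.
set N := u - 1%:M in uN *.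
pose G i := N ^+ i *+ 'C(k, i).
have G_big i : (m <= i)%N -> G i = 0.
  by move=> mi; rewrite /G -(subnKC mi) exprD uN mul0r mul0rn.
rewrite -(big_mkord xpredT G) -(big_mkord xpredT G).
(* Both sums are extended to a common range: the terms from [m] on vanish by nilpotency, those
   beyond [k] because ['C(k, i)] is 0. *)
transitivity (\sum_(0 <= i < m + k.+1) G i); last first.
  rewrite (@big_cat_nat _ _ _ m) ?leq_addr //= [X in _ + X]big_nat_cond.
  rewrite [X in _ + X]big1 ?addr0 //.
  by move=> i /andP[/andP[/G_big]].
rewrite [RHS](@big_cat_nat _ _ _ k.+1) ?leq_addl //= [X in _ + X]big_nat_cond.
by rewrite [X in _ + X]big1 ?addr0 // => i /andP[/andP[ki _] _]; rewrite /G bin_small.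
Qed.

Lemma unipotent_exp_poly m (u : 'M[F]_m) : (u - 1%:M) ^+ m = 0 ->
  exists p : 'M[{poly F}]_m, forall (k : nat) i j, (p i j).[k%:R] = (u ^+ k) i j.
Proof.
move=> uN.
exists (\matrix_(i, j) \sum_(a < m) (((u - 1%:M) ^+ a) i j)%:P * bin_poly a) => k i j.
rewrite mxE horner_sum (unipotent_expr _ uN) summxE; apply: eq_bigr => a _.
by rewrite hornerM hornerC horner_bin_poly mulmxnE mulr_natr.
Qed.

Lemma scalemx_expr m (c : F) (A : 'M[F]_m) k : (c *: A) ^+ k = c ^+ k *: A ^+ k.
Proof.
elim: k => [|k IH]; first by rewrite !expr0 scale1r.
by rewrite !exprS IH -!mulmxE -scalemxAl -scalemxAr scalerA.
Qed.

Lemma diag_mx_expr m (D : 'rV[F]_m) k :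
  diag_mx D ^+ k = diag_mx (\row_j D 0 j ^+ k).
Proof.
elim: k => [|k IH].
  rewrite expr0 -idmxE; apply/matrixP => i j; rewrite !mxE.
  by rewrite expr0.
rewrite exprS IH -mulmxE mulmx_diag; congr diag_mx.
by apply/rowP => j; rewrite !mxE exprS.
Qed.

Lemma conj_expr m (P A B : 'M[F]_m) k : P \in unitmx -> P *m A = B *m P ->
  A ^+ k = invmx P *m B ^+ k *m P.
Proof.
move=> Pu PA; rewrite -[LHS](mulKmx Pu) -mulmxA; congr (_ *m _).
elim: k => [|k IH]; first by rewrite !expr0 -!idmxE mulmx1 mul1mx.
by rewrite !exprS -!mulmxE mulmxA PA -mulmxA IH mulmxA.
Qed.

(** In the k-th power, s contributes the exponentials of the [c * D 0 b] and u a polynomial in k.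
    The twist turns the former into the [D 0 b], that is into s, and k = 0 turns the latter into
    [u ^+ 0], the identity. *)
Lemma twisted_value_jordan (phi : F -> F) m (c : F) (s u P : 'M[F]_m) (D : 'rV[F]_m) :
    phi 1 = 1 -> {morph phi : x y / x * y} -> P \in unitmx ->
    P *m s = diag_mx D *m P -> s *m u = u *m s -> (u - 1%:M) ^+ m = 0 ->
    c != 0 -> (forall j, D 0 j != 0) -> (forall j, phi (c * D 0 j) = D 0 j) ->
  forall i j, twisted_value phi (fun k => ((c *: (s *m u)) ^+ k) i j) (s i j).
Proof.
move=> phi1 phiM Pu Ps su uN c0 D0 phiD i j.
have [p pE] := unipotent_exp_poly uN.
have /(congr1 (fun M : 'M[F]_m => M i j)) := mulmx1 s; rewrite mxE => <-.
have sE := conj_expr _ Pu Ps.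
apply: (@twisted_value_ext _ _
  (fun k => \sum_a (\sum_b invmx P i b * (c * D 0 b) ^+ k * P b a) * (p a j).[k%:R])).
  move=> k; rewrite scalemx_expr mulmxE exprMn_comm // -mulmxE.
  rewrite mxE mxE big_distrr; apply: eq_bigr => a _ /=.
  rewrite pE mulrA; congr (_ * _).
  rewrite sE mxE big_distrr; apply: eq_bigr => b _ /=.
  rewrite diag_mx_expr mul_mx_diag !mxE exprMn.
  by rewrite [RHS]mulrA [in RHS]mulrCA.
apply: twisted_value_sum => // a; apply: twisted_valueM => //; last first.
  have := twisted_value_poly phi1 (p a j).
  have -> : (p a j).[0] = (u ^+ 0) a j by rewrite -pE.
  by rewrite expr0 -idmxE.
have -> : s i a = \sum_b invmx P i b * D 0 b * P b a.
  have := sE 1%N; rewrite !expr1 => ->; rewrite mxE.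
  by apply: eq_bigr => b _; rewrite mul_mx_diag mxE.
apply: twisted_value_sum => // b.
apply: twisted_valueM => //; last exact: twisted_value_cst.
apply: twisted_valueM => //; first exact: twisted_value_cst.
by rewrite -{2}phiD; apply: twisted_value_exp; rewrite mulf_neq0.
Qed.

(** Row j of P is an eigenvector of s. Its last nonzero image under the powers of N = u - 1 still is
    one, as N commutes with s, and it is fixed by u. *)
Lemma jordan_eigenvalue m (s u P : 'M[F]_m) (D : 'rV[F]_m) j :
    P \in unitmx -> P *m s = diag_mx D *m P ->
    s *m u = u *m s -> (u - 1%:M) ^+ m = 0 ->
  eigenvalue (s *m u) (D 0 j).
Proof.
move=> Pu Ps su uN; set N := u - 1%:M in uN.
have sN k : s *m N ^+ k = N ^+ k *m s.
  rewrite mulmxE; apply: commrX; rewrite /GRing.comm -mulmxE /N.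
  by rewrite mulmxBr mulmxBl su mulmx1 mul1mx.
have v0 : row j P != 0.
  apply: contraTneq Pu => rP0; rewrite -row_free_unit; apply/negP => /row_freeP[B PB].
  have /rowP/(_ j) := congr1 (row j) PB; rewrite row_mul rP0 mul0mx !mxE eqxx.
  by move/eqP; rewrite eq_sym oner_eq0.
have vs : row j P *m s = D 0 j *: row j P.
  by rewrite -row_mul Ps row_mul row_diag_mx -scalemxAl -rowE.
have exN : exists k, row j P *m N ^+ k == 0 by exists m; rewrite uN mulmx0.
case: (ex_minnP exN) => [[|k]].
  by rewrite expr0 -idmxE mulmx1 (negPf v0).
move=> /eqP vk kmin; apply/eigenvalueP; exists (row j P *m N ^+ k); last first.
  by apply/negP => /kmin; rewrite ltnn.
have wu : row j P *m N ^+ k *m u = row j P *m N ^+ k.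
  apply/eqP; rewrite -subr_eq0 -{2}[_ *m N ^+ k]mulmx1 -mulmxBr -/N -mulmxA mulmxE.
  by rewrite -exprSr vk.
by rewrite su mulmxA wu -mulmxA -sN mulmxA vs -scalemxAl.
Qed.

(** With the identity as twist, the twisted value of an entry of the powers of g is that entry of s.
    This carries a block shape of g over to s. *)
Lemma jordan_unique_entry m (s u g : 'M[F]_m) i j :
    g \in unitmx -> diagonalizable s -> s *m u = u *m s -> (u - 1%:M) ^+ m = 0 ->
    g = s *m u -> (forall k, (g ^+ k) i j = 0) -> s i j = 0.
Proof.
move=> gu [P Pu /diagonalizable_forPex[D /(simmxP Pu) Ps]] su uN gE g0.
have D0 a : D 0 a != 0.
  apply/negP => /eqP Da; have := jordan_eigenvalue a Pu Ps su uN.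
  rewrite -gE Da => /eigenvalueP[v]; rewrite scale0r => vg /eqP; apply.
  by rewrite -[v](mulmxK gu) vg mul0mx.
have := @twisted_value_jordan id m 1 s u P D erefl (fun _ _ => erefl) Pu Ps su uN
  (oner_neq0 F) D0 (fun a => mul1r _) i j.
by apply: twisted_value0 => // k; rewrite scale1r -gE.
Qed.

End JordanDecomposition.

Lemma scalar_mx_expr (A : pzRingType) m (a : A) k :
  a%:M ^+ k = (a ^+ k)%:M :> 'M[A]_m.
Proof.
elim: k => [|k IH]; first by rewrite !expr0 -idmxE.
by rewrite !exprS IH -mulmxE -scalar_mxM.
Qed.

(** * Unipotent and diagonalizable block diagonal matrices *)

Section BlockDiagonal.
Variable F : fieldType.

(** The minimal polynomial divides a power of X, so it is itself one, of degree at most m. *)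
Lemma nilpotent_expr_dim m k (N : 'M[F]_m) : N ^+ k = 0 -> N ^+ m = 0.
Proof.
case: m N => [|m] N Nk; first by apply/matrixP => -[].
have minN j : (mxminpoly N %| 'X^j) = (N ^+ j == 0).
  by rewrite dvd_mxminpoly rmorphXn /= horner_mx_X.
have : mxminpoly N %| ('X - 0%:P) ^+ k by rewrite subr0 minN Nk.
move=> /dvdp_exp_XsubCP[j _]; rewrite subr0 => minNj.
apply/eqP; rewrite -minN (eqp_dvdl _ minNj) dvdp_exp2l //.
have := dvdp_leq (monic_neq0 (char_poly_monic N)) (mxminpoly_dvd_char N).
by rewrite (eqp_size minNj) size_polyXn size_char_poly.
Qed.

Lemma block_diag_expr m1 m2 (A : 'M[F]_m1) (B : 'M[F]_m2) k :
  block_mx A 0 0 B ^+ k = block_mx (A ^+ k) 0 0 (B ^+ k).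
Proof.
elim: k => [|k IH]; first by rewrite !expr0 -!idmxE -scalar_mx_block.
by rewrite !exprS IH -!mulmxE mulmx_block !(mulmx0, mul0mx, addr0, add0r).
Qed.

Lemma block_diag_sub1 m1 m2 (A : 'M[F]_m1) (B : 'M[F]_m2) :
  block_mx A 0 0 B - 1%:M = block_mx (A - 1%:M) 0 0 (B - 1%:M).
Proof. by rewrite scalar_mx_block opp_block_mx add_block_mx !subr0. Qed.

Lemma block_diag_unit m1 m2 (A : 'M[F]_m1) (B : 'M[F]_m2) :
  (block_mx A 0 0 B \in unitmx) = (A \in unitmx) && (B \in unitmx).
Proof. by rewrite !unitmxE det_ublock unitrM. Qed.

Lemma unipotent_block m1 m2 (A : 'M[F]_m1) (B : 'M[F]_m2) :
  (block_mx A 0 0 B - 1%:M) ^+ (m1 + m2) = 0 <->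
  (A - 1%:M) ^+ m1 = 0 /\ (B - 1%:M) ^+ m2 = 0.
Proof.
rewrite block_diag_sub1 block_diag_expr; split=> [|[A1 B1]].
  rewrite -[0 in RHS]block_mx0 => /eq_block_mx[A1 _ _ B1].
  by split; apply: nilpotent_expr_dim; eassumption.
have -> : (A - 1%:M) ^+ (m1 + m2) = 0 by rewrite exprD A1 mul0r.
have -> : (B - 1%:M) ^+ (m1 + m2) = 0 by rewrite exprD B1 mulr0.
exact: block_mx0.
Qed.

(** The left halves of the rows of a diagonalizing P satisfy the eigenvector equation for A and span
    the space; a basis extracted from them diagonalizes A. *)
Lemma diagonalizable_block_ul m1 m2 (A : 'M[F]_m1) (B : 'M[F]_m2) :
  diagonalizable (block_mx A 0 0 B) -> diagonalizable A.
Proof.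
move=> [P Pu /diagonalizable_forPex[D /(simmxP Pu)]].
rewrite -{1}[P]hsubmxK mul_row_block !mulmx0 addr0 => PA.
have {}PA : lsubmx P *m A = diag_mx D *m lsubmx P.
  have := congr1 lsubmx PA; rewrite row_mxKl => ->.
  by rewrite -mulmx_lsub.
have full : row_full (lsubmx P).
  apply/row_fullP; exists (usubmx (invmx P)).
  by rewrite mulmx_lsub mul_usub_mx mulVmx // -/(ulsubmx _) scalar_mx_block block_mxKul.
exists (rowsub (fullrankfun full) (lsubmx P)); first exact: fullrowsub_unit.
apply/diagonalizable_forPex; exists (colsub (fullrankfun full) D).
apply/simmxP; first exact: fullrowsub_unit.
rewrite mul_rowsub_mx PA; apply/matrixP => i j.
by rewrite mxE !mul_diag_mx !mxE.
Qed.

Lemma diagonalizable_block m1 m2 (A : 'M[F]_m1) (B : 'M[F]_m2) :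
  diagonalizable A -> diagonalizable B -> diagonalizable (block_mx A 0 0 B).
Proof.
move=> [P Pu /diagonalizable_forPex[D /(simmxP Pu) PA]].
move=> [P' Pu' /diagonalizable_forPex[D' /(simmxP Pu') PB]].
have Puu : block_mx P 0 0 P' \in unitmx by rewrite block_diag_unit Pu.
exists (block_mx P 0 0 P') => //; apply/diagonalizable_forPex.
exists (row_mx D D'); apply/(simmxP Puu); rewrite diag_mx_row.
by rewrite !mulmx_block !(mulmx0, mul0mx, addr0, add0r) PA PB.
Qed.

End BlockDiagonal.

(** * Semisimple parts of block diagonal matrices *)

Section SemisimplePart.
Variable R : realType.

Lemma ss_part1 m : ss_part (1%:M : 'M[Cpx R]_m) 1%:M.
Proof.
split; last first.
  exists 1%:M; rewrite subrr !mulmx1 expr0n; split=> //.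
  by case: m => [|m] //; apply/matrixP => -[].
exists 1%:M; rewrite ?unitmx1 //; apply/diagonalizable_forPex.
exists (const_mx 1); rewrite diag_const_mx; apply/simmxP; rewrite ?unitmx1 //.
Qed.

Lemma ss_part_block m1 m2 (g s : 'M[Cpx R]_m1) (g' s' : 'M[Cpx R]_m2) :
  ss_part g s -> ss_part g' s' ->
  ss_part (block_mx g 0 0 g') (block_mx s 0 0 s').
Proof.
move=> [sD [u [uN su gE]]] [sD' [u' [uN' su' gE']]].
split; first exact: diagonalizable_block.
exists (block_mx u 0 0 u'); rewrite !mulmx_block !(mulmx0, mul0mx, addr0, add0r).
split; [exact/unipotent_block | by rewrite su su' | by rewrite gE gE'].
Qed.

Lemma ss_part_block1 m (g : 'M[Cpx R]_m) (s : 'M[Cpx R]_(m + 1)) :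
  g \in unitmx -> ss_part (block_mx g 0 0 1%:M) s ->
  ss_part g (ulsubmx s) /\ s = block_mx (ulsubmx s) 0 0 1%:M.
Proof.
move=> gU [sD [u [uN su gE]]].
have gu : block_mx g 0 0 (1%:M : 'M[Cpx R]_1) \in unitmx by rewrite block_diag_unit gU unitmx1.
have sE : s = block_mx (ulsubmx s) 0 0 (drsubmx s).
  rewrite -{1}[s]submxK; congr block_mx; apply/matrixP => i j.
    rewrite !mxE; apply: (jordan_unique_entry gu sD su uN gE) => k.
    by rewrite block_diag_expr block_mxEur mxE.
  rewrite !mxE; apply: (jordan_unique_entry gu sD su uN gE) => k.
  by rewrite block_diag_expr block_mxEdl mxE.
have : s \in unitmx /\ u \in unitmx.
  by apply/andP; rewrite -unitmx_mul -gE.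
rewrite {1}sE block_diag_unit => -[/andP[au bu] uu].
move: gE su uN; rewrite sE -[u]submxK !mulmx_block !(mul0mx, addr0, add0r, mulmx0).
move=> /eq_block_mx[gE ur dl bE].
(* The off-diagonal blocks of [s *m u] vanish and the diagonal blocks of s are invertible, so u is
   block diagonal too; its last block, unipotent of size 1, is then 1. *)
have {ur} ur : ursubmx u = 0 by rewrite -[LHS](mulKmx au) -ur mulmx0.
have {dl} dl : dlsubmx u = 0 by rewrite -[LHS](mulKmx bu) -dl mulmx0.
rewrite ur dl !mulmx0 !mul0mx => /eq_block_mx[su _ _ _] /unipotent_block[uN uN'].
have u1 : drsubmx u = 1%:M by apply/eqP; rewrite -subr_eq0 -[_ - _]expr1 uN'.
rewrite block_mxKul; split; last by rewrite bE u1 mulmx1.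
split; last by exists (ulsubmx u).
by apply: (@diagonalizable_block_ul _ _ _ _ (drsubmx s)); rewrite -sE.
Qed.

End SemisimplePart.

(** * Points of a Zariski closure obtained by twisting *)

Section ZariskiClosure.

Lemma entries_eval_map (k : fieldType) (A : comUnitRingType) (f : {rmorphism k -> A})
    m (x : 'M[k]_m) P :
  entries_eval f (map_mx f x) P = f (entries_eval id x P).
Proof.
rewrite /entries_eval /mpoly.mmap rmorph_sum; apply: eq_bigr => mon _ /=.
rewrite rmorphM /mpoly.mmap1 rmorph_prod; congr (_ * _); apply: eq_bigr => i _.
by rewrite -map_mxvec mxE rmorphXn.
Qed.

Lemma twisted_value_entries_eval (F : numFieldType) (phi : F -> F) (k : fieldType)
    (f : k -> F) m (g : nat -> 'M[F]_m) (s : 'M[F]_m) P :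
    phi 1 = 1 -> {morph phi : x y / x * y} ->
    (forall i j, twisted_value phi (fun n => g n i j) (s i j)) ->
  twisted_value phi (fun n => entries_eval f (g n) P) (entries_eval f s P).
Proof.
move=> phi1 phiM gs; apply: twisted_value_sum => // mon.
apply: twisted_valueM => //; first exact: twisted_value_cst.
apply: twisted_value_prod => // i; apply: twisted_valueX => //.
case/mxvec_indexP: i => i j; rewrite mxvecE.
by apply: twisted_value_ext (gs i j) => n; rewrite mxvecE.
Qed.

(** An equation of the closure, evaluated on the powers of g, is an exponential polynomial that is
    identically 0; its twisted value is the same equation evaluated at s. *)
Lemma zariski_closure_twisted (F : numFieldType) (phi : F -> F) (k : fieldType)
    (f : {rmorphism k -> F}) m (X : set 'M[k]_m) (g : 'M[k]_m) (s : 'M[F]_m) :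
    phi 1 = 1 -> {morph phi : x y / x * y} -> (forall n, X (g ^+ n)) ->
    s \in unitmx ->
    (forall i j, twisted_value phi (fun n => (map_mx f g ^+ n) i j) (s i j)) ->
  zariski_closure X f s.
Proof.
move=> phi1 phiM Xg su gs; split=> // P XP.
have map_expr n : map_mx f (g ^+ n) = map_mx f g ^+ n.
  elim: n => [|n IH]; first by rewrite !expr0 -!idmxE map_mx1.
  by rewrite !exprS -!mulmxE map_mxM IH.
have := twisted_value_entries_eval f P phi1 phiM gs; apply: twisted_value0 => n.
by rewrite -map_expr entries_eval_map XP ?rmorph0.
Qed.

(** Identifies the points over [emb \o Ql_inc] with those over [ratr]: equations depend only on the
    values of the morphism. *)
Lemma algebraic_group_eq (k : fieldType) m (G : subfunctor k m)
    (A : comUnitRingType) (f g : {rmorphism k -> A}) :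
  algebraic_group G -> f =1 g -> G A f = G A g.
Proof.
move=> [[I ->] _] fg.
have eval_eq x P : entries_eval f x P = entries_eval g x P :> A.
  by rewrite /entries_eval /mpoly.mmap; apply: eq_bigr => i _; rewrite fg.
by apply/seteqP; split=> x [xu xI]; split=> // P /xI; rewrite eval_eq.
Qed.

End ZariskiClosure.

(** * Frobenius elements and the cyclotomic character *)

Section Frobenius.
Variables (R : realType) (K : fieldExtType rat) (iota : {rmorphism K -> algC}).
Implicit Types g h : algC -> algC.

Lemma G_K_comp g h : G_K iota g -> G_K iota h -> G_K iota (g \o h).
Proof.
move=> [[gB gM gbij] gK] [[hB hM hbij] hK]; split; last by move=> x Kx /=; rewrite hK ?gK.
split; last exact: bij_comp.
  by move=> x y /=; rewrite hB gB.
by split=> [|x y] /=; [rewrite hM.1 gM.1|rewrite hM.2 gM.2].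
Qed.

Lemma G_K_id : G_K iota id.
Proof. by split=> //; split=> //; exists id. Qed.

Lemma G_K_iter g n : G_K iota g -> G_K iota (iter n g).
Proof.
move=> gG; elim: n => [|n IH]; first exact: G_K_id.
exact: G_K_comp gG IH.
Qed.

Lemma G_K_X g x n : G_K iota g -> g (x ^+ n) = g x ^+ n.
Proof.
move=> [[_ [g1 gM] _] _]; elim: n => [|n IH]; first by rewrite !expr0.
by rewrite !exprS gM IH.
Qed.

Lemma finite_ext_base : finite_ext iota (baseK iota).
Proof.
split=> //.
- by move=> _ _ [x _ <-] [y _ <-]; exists (x - y); rewrite ?rmorphB.
- by move=> _ _ [x _ <-] [y _ <-]; exists (x / y); rewrite ?fmorph_div.
- exists [:: 1] => _ [x _ <-]; exists (fun=> x).
  by rewrite big_ord_recl big_ord0 addr0 mulr1.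
Qed.

(** [fset_set] would give an infinite residue ring the norm 0. Then the Frobenius congruence at x =
    0, where 0 ^ 0 = 1, would put -1 in M. *)
Lemma place_norm_gt0 (v : set K) g : is_frobenius iota v g -> (0 < place_norm iota v)%N.
Proof.
move=> [[[gB _ _] _] [M [_ _ MM [M1 _] _] Mg]]; case: place_norm Mg => [|//].
have g0 : g 0 = 0 by rewrite -[X in g X](subrr 0) gB subrr.
move=> /(_ 0 Aint0); rewrite expr0 g0 sub0r => /(MM (-1)).
by rewrite mulrNN mulr1 => /(_ (rpredN1 _))/M1.
Qed.

(* Roots of unity of order prime to v stay distinct modulo v: if w^n = 1 with w <>
   1, then 0 = 1 + w + ... + w^(n-1) is congruent to n modulo w - 1. *)
Lemma place_above_unity_root (v : set K) M n w :
  place_above iota v M -> (0 < n)%N -> w ^+ n = 1 -> M (w - 1) -> w != 1 -> M n%:R.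
Proof.
move=> [_ MD MM _ _] n0 wn Mw w1.
have wA : w \in Aint by apply: (Aint_unity_root n0); apply/unity_rootP.
have sum0 : \sum_(i < n) w ^+ i = 0.
  apply/eqP; have /eqP := subrX1 w n; rewrite wn subrr eq_sym mulf_eq0 subr_eq0.
  by rewrite (negPf w1).
have -> : n%:R = (- \sum_(i < n) \sum_(j < i) w ^+ j) * (w - 1).
  have -> : n%:R = \sum_(i < n) 1 :> algC by rewrite sumr_const card_ord.
  transitivity (\sum_(i < n) 1 - \sum_(i < n) w ^+ i); first by rewrite sum0 subr0.
  rewrite mulNr mulrC mulr_sumr -sumrB -sumrN; apply: eq_bigr => i _.
  by rewrite -subrX1 opprB.
apply: MM => //; rewrite rpredN; apply: rpred_sum => i _.
by apply: rpred_sum => j _; rewrite rpredX.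
Qed.

(** Both sides are roots of unity of order dividing l^k and they agree modulo M. If they differed,
    l^k would lie in the prime M, hence l in v. *)
Lemma frobenius_unity_root (l : primeT) (v : set K) g k z :
    prime_place iota v -> ~ v (val l)%:R -> is_frobenius iota v g ->
    (val l ^ k)%N.-primitive_root z ->
  g z = z ^+ place_norm iota v.
Proof.
move=> v_prime vl [gG [M Mv Mg]] z_prim; set q := place_norm iota v.
have [MA MD MM [M1 M_prime] Mv'] := Mv.
have n0 := prim_order_gt0 z_prim.
have z0 : z != 0.
  apply: contra_eq_neq (prim_expr_order z_prim) => ->.
  by rewrite expr0n (gtn_eqF n0) eq_sym oner_neq0.
have zA := Aint_prim_root z_prim.
have zVA : z^-1 \in Aint.
  apply: (Aint_unity_root n0); apply/unity_rootP.
  by rewrite exprVn (prim_expr_order z_prim) invr1.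
have gz : g z ^+ (val l ^ k) = 1.
  by rewrite -G_K_X // (prim_expr_order z_prim); case: gG => -[_ []].
apply/eqP; apply: contraT => gzq.
have : M (val l ^ k)%:R.
  apply: (@place_above_unity_root v M _ (g z / z ^+ q)) => //.
  - by rewrite exprMn gz mul1r exprVn exprAC (prim_expr_order z_prim) expr1n invr1.
  - have -> : g z / z ^+ q - 1 = (z^-1) ^+ q * (g z - z ^+ q).
      by rewrite mulrBr mulrC exprVn mulVf // expf_neq0.
    by apply: MM; rewrite ?rpredX //; exact: Mg.
  - by apply: contraNneq gzq => e; rewrite -[g z](divfK (expf_neq0 q z0)) e mul1r.
move=> Mlk; exfalso; apply: vl; apply/Mv'; rewrite rmorph_nat.
elim: (k) Mlk => [|j IH]; first by move/M1.
rewrite expnS natrM => /M_prime[] //; rewrite Aint_Cnat ?natr_nat //.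
Qed.

Lemma cyclotomic_char_eq (l : primeT) (Q : Ql R l) (chi : (algC -> algC) -> Q) g (a : nat) :
    cyclotomic_char (G_K iota) chi -> G_K iota g ->
    (forall k z, (val l ^ k)%N.-primitive_root z -> g z = z ^+ a) ->
  chi g = a%:R.
Proof.
move=> chiP gG ga; have [abs_ge0 abs_eq0 _ _] := @Ql_nonarch _ _ Q.
have l_prime : prime (val l) := valP l.
apply/eqP; rewrite -subr_eq0; apply/eqP/abs_eq0/le_anti; rewrite abs_ge0 andbT.
rewrite leNgt; apply/negP => abs_gt0; set e := Ql_abs _ in abs_gt0.
(* Such a k satisfies 1/e < k < l^k, against the bound l^-k on the distance e. *)
have [k ke] : exists k : nat, e^-1 < k%:R.
  by exists (Num.truncn e^-1).+1; rewrite truncnS_gt.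
have lk0 : (0 < val l ^ k)%N by rewrite expn_gt0 prime_gt0.
have [z z_prim] := C_prim_root_exists lk0.
have := chiP g k a z gG z_prim (ga k z z_prim); rewrite leNgt => /negP; apply.
rewrite -natrX -[ltRHS]invrK ltf_pV2 ?posrE ?invr_gt0 ?ltr0n //.
by rewrite (lt_trans ke) // ltr_nat ltn_expl // prime_gt1.
Qed.

Lemma frobenius_iter_unity_root (l : primeT) (v : set K) g k z n :
    prime_place iota v -> ~ v (val l)%:R -> is_frobenius iota v g ->
    (val l ^ k)%N.-primitive_root z ->
  iter n g z = z ^+ (place_norm iota v ^ n).
Proof.
move=> v_prime vl gF z_prim; elim: n => [|n IH]; first by rewrite expr1.
by rewrite iterS IH G_K_X ?(frobenius_unity_root v_prime vl gF z_prim) -?exprM ?expnS //; case: gF.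
Qed.

Lemma cyclotomic_char_frobenius (l : primeT) (Q : Ql R l) (chi : (algC -> algC) -> Q)
    (v : set K) g n :
    cyclotomic_char (G_K iota) chi -> prime_place iota v -> ~ v (val l)%:R ->
    is_frobenius iota v g ->
  chi (iter n g) = (place_norm iota v)%:R ^+ n.
Proof.
move=> chiP v_prime vl gF; rewrite -natrX; apply: cyclotomic_char_eq => //.
  by apply: G_K_iter; case: gF.
by move=> k z z_prim; apply: frobenius_iter_unity_root z_prim.
Qed.

(** * The normalized Frobenius and its semisimple part *)

Section LadicRepresentation.
Variables (d : nat) (n : int) (Psi : 'M[rat]_d) (l : primeT) (Q : Ql R l).
Variables (chi : (algC -> algC) -> Q) (rho : (algC -> algC) -> 'M[Q]_d).
Hypotheses (chiP : cyclotomic_char (G_K iota) chi).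
Hypothesis rhoP : ladic_rep iota n Psi chi rho.

Lemma ladic_rep_iter g m : G_K iota g -> rho (iter m g) = rho g ^+ m.
Proof.
have [rhoU rhoM _ _] := rhoP; move=> gG; elim: m => [|m IH].
  (* [rho id] is idempotent and invertible, hence the identity. *)
  have := rhoM id id G_K_id G_K_id; rewrite expr0 -idmxE /= => /(congr1 (mulmx (invmx (rho id)))).
  by rewrite mulKmx ?mulVmx //; exact/rhoU/G_K_id.
by rewrite exprS -IH -mulmxE -rhoM //; apply: G_K_iter.
Qed.

Variables (emb : {rmorphism Q -> Cpx R}) (Fr : set K -> algC -> algC) (v : set K).
Hypotheses (v_good : good_place iota n rho v) (v_Fr : is_frobenius iota v (Fr v)).

Let q := place_norm iota v.
Let q_gt0 : (0 < q)%N := place_norm_gt0 v_Fr.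
Let sqrt_q_gt0 : 0 < Num.sqrt (q%:R : R).
Proof. by rewrite sqrtr_gt0 ltr0n. Qed.

Lemma qhalf_gt0 m : 0 < qhalf R iota v m.
Proof. by rewrite /qhalf /RtoC -[0]/((0:R)%:C)%C ltcR exprz_gt0. Qed.

Lemma qhalfN m : qhalf R iota v (- m) = (qhalf R iota v m)^-1.
Proof. by rewrite /qhalf /RtoC -invr_expz fmorphV. Qed.

Lemma qhalf_m2 : qhalf R iota v (- 2) = q%:R^-1.
Proof.
rewrite qhalfN /qhalf -exprnP sqr_sqrtr ?ler0n //.
by rewrite /RtoC; congr (_^-1); rewrite rmorph_nat.
Qed.

Lemma norm_frob_unit : norm_frob iota n emb rho Fr v \in unitmx.
Proof.
have [rhoU _ _ _] := rhoP; rewrite unitmxZ ?unitfE ?gt_eqF ?qhalf_gt0 //.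
by rewrite map_unitmx; apply: rhoU; case: v_Fr.
Qed.

Lemma norm_frob_tildeE : norm_frob_tilde iota n emb chi rho Fr v =
  block_mx (norm_frob iota n emb rho Fr v) 0 0 1%:M.
Proof.
have [v_prime vl _ _] := v_good.
have chiF := cyclotomic_char_frobenius 1 chiP v_prime vl v_Fr.
rewrite /norm_frob_tilde /rho_tilde map_block_mx mulmx_block.
rewrite !map_mx0 !(mulmx0, mul0mx, addr0, add0r) mul_scalar_mx map_scalar_mx.
rewrite -scalar_mxM qhalf_m2 [chi _]chiF expr1 rmorph_nat mulVf //.
by rewrite pnatr_eq0 -lt0n.
Qed.

(* Normalizing rho~ (Fr v) divides each eigenvalue by its absolute value; z |-> z /
   |z| is multiplicative, hence preserves the monomial relations between
   eigenvalues. *)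
Lemma ss_part_zariski_closure s :
    ss_part (norm_frob iota n emb rho Fr v) s ->
  zariski_closure [set rho_tilde chi rho g | g in G_K iota] emb
    (block_mx s 0 0 1%:M).
Proof.
have [v_prime vl _ v_abs] := v_good; have FrG : G_K iota (Fr v) by case: v_Fr.
move=> [[P Pu /diagonalizable_forPex[D /(simmxP Pu) Ps]] [u [uN su nfE]]].
pose phi (z : Cpx R) := z / `|z|.
have phi1 : phi 1 = 1 by rewrite /phi normr1 divr1.
have phiM : {morph phi : x y / x * y} by move=> x y; rewrite /phi normrM invfM mulrACA.
have su_unit : s \in unitmx by have := norm_frob_unit; rewrite nfE unitmx_mul => /andP[].
pose c := (qhalf R iota v n)^-1.
have c_gt0 : 0 < c by rewrite invr_gt0 qhalf_gt0.
have c0 : c != 0 by rewrite gt_eqF.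
have rhoE : map_mx emb (rho (Fr v)) = c *: (s *m u).
  by rewrite -nfE scalerA mulVf ?scale1r // gt_eqF ?qhalf_gt0.
(* The [c * D 0 j] are eigenvalues of the Frobenius, and c is their prescribed absolute value
   q^(-n/2). *)
have cD j : `|c * D 0 j| = c.
  have := v_abs (Fr v) emb (c * D 0 j) v_Fr; rewrite -[RtoC _]/(qhalf R iota v (- n)) qhalfN.
  apply; rewrite map_char_poly -eigenvalue_root_char -/(map_mx _ _) rhoE.
  have /eigenvalueP[w wsu w0] := jordan_eigenvalue j Pu Ps su uN.
  by apply/eigenvalueP; exists w => //; rewrite -scalemxAr wsu scalerA.
have D0 j : D 0 j != 0.
  by apply: contra_neq c0 => Dj; rewrite -(cD j) Dj mulr0 normr0.
have phiD j : phi (c * D 0 j) = D 0 j by rewrite /phi cD mulrAC divff ?mul1r.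
have s_twisted := twisted_value_jordan phi1 phiM Pu Ps su uN c0 D0 phiD.
have chiF : chi (Fr v) = q%:R := cyclotomic_char_frobenius 1 chiP v_prime vl v_Fr.
apply: (zariski_closure_twisted (phi := phi) (g := rho_tilde chi rho (Fr v))) => //.
- move=> m; exists (iter m (Fr v)); first exact: G_K_iter.
  rewrite /rho_tilde block_diag_expr scalar_mx_expr chiF ladic_rep_iter //.
  by rewrite (cyclotomic_char_frobenius m chiP v_prime vl v_Fr).
- by rewrite block_diag_unit su_unit unitmx1.
have cst0 (f : nat -> Cpx R) : (forall m, f m = 0) -> twisted_value phi f 0.
  by move=> f0; apply: twisted_value_ext (twisted_value_cst phi1 0) => m; rewrite f0.
rewrite /rho_tilde map_block_mx !map_mx0 map_scalar_mx chiF rmorph_nat rhoE.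
move=> i j; case: (split_ordP i) => i' ->; case: (split_ordP j) => j' ->.
- rewrite block_mxEul; apply: twisted_value_ext (s_twisted i' j') => m.
  by rewrite block_diag_expr block_mxEul.
- by rewrite block_mxEur mxE; apply: cst0 => m; rewrite block_diag_expr block_mxEur mxE.
- by rewrite block_mxEdl mxE; apply: cst0 => m; rewrite block_diag_expr block_mxEdl mxE.
rewrite block_mxEdr !ord1 mxE eqxx.
have q0 : q%:R != 0 :> Cpx R by rewrite pnatr_eq0 -lt0n.
(* The cyclotomic entry q^k twists to 1, so the point lies in the kernel of N. *)
have phiq : phi q%:R = 1 by rewrite /phi normr_nat divff.
have := twisted_value_exp phi q0; rewrite phiq; apply: twisted_value_ext => m.
by rewrite block_diag_expr block_mxEdr scalar_mx_expr mxE eqxx.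
Qed.

End LadicRepresentation.
End Frobenius.

(** * Extension of a matrix group by -1 *)

Section SignedGroups.
Variables (R : realType) (d : nat).
Implicit Types (G H : set 'M[Cpx R]_d) (x y : 'M[Cpx R]_d).

Lemma unitmxN x : (- x \in unitmx) = (x \in unitmx).
Proof. by rewrite -scaleN1r unitmxZ ?unitfE ?oppr_eq0 ?oner_neq0. Qed.

Lemma invmxN x : invmx (- x) = - invmx x.
Proof.
have [xu|xu] := boolP (x \in unitmx).
  by rewrite -scaleN1r invmxZ ?scaleN1r ?unitmxN // invrN1 scaleN1r.
by rewrite /invmx unitmxN (negPf xu).
Qed.

Lemma pmN G x : pm G x -> pm G (- x).
Proof. by move=> [Gx|[y Gy <-]]; [right; exists x|left; rewrite opprK]. Qed.

Lemma pm_matrix_group G : matrix_group G -> matrix_group (pm G).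
Proof.
move=> [GU G1 GM GV]; split.
- by move=> x [/GU//|[y /GU yu <-]]; rewrite unitmxN.
- by left.
- move=> x y [Gx|[x' Gx <-]]; first move=> [Gy|[y' Gy <-]].
  + by left; apply: GM.
  + by rewrite mulmxN; apply: pmN; left; apply: GM.
  move=> [Gy|[y' Gy <-]]; rewrite mulNmx; apply: pmN; first by left; apply: GM.
  by rewrite mulmxN; apply: pmN; left; apply: GM.
- move=> x [Gx|[x' Gx <-]]; first by left; apply: GV.
  by rewrite invmxN; apply: pmN; left; apply: GV.
Qed.

Lemma pm_id G : matrix_group G -> G (- 1%:M) -> pm G = G.
Proof.
move=> [_ _ GM _] GN1; apply/seteqP; split=> x; last by left.
by move=> [//|[y Gy <-]]; rewrite -[y]mul1mx -mulNmx; apply: GM.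
Qed.

(** When G contains -1, [pm H] is a compact subgroup of G containing H; maximality forces it to
    equal H. *)
Lemma maximal_compact_N1 G H : matrix_group G -> maximal_compact G H ->
  compact (pm H) -> G (- 1%:M) -> H (- 1%:M).
Proof.
move=> Ggrp [Hgrp HG _ Hmax] Hc GN1.
rewrite -(Hmax (pm H)) //.
- by apply: pmN; left; case: Hgrp.
- exact: pm_matrix_group.
- by rewrite -(pm_id Ggrp GN1) => x [/HG|[y /HG Gy <-]]; [left|right; exists y].
- by left.
Qed.

Lemma pm_conj G h x : matrix_group G -> pm G h -> G x -> G (h *m x *m invmx h).
Proof.
move=> [_ _ GM GV] [Gh|[h' Gh' <-]] Gx; first by apply: (GM); [apply: GM|apply: GV].
by rewrite invmxN mulmxN !mulNmx opprK; apply: (GM); [apply: GM|apply: GV].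
Qed.

(** If [- y] is in G with y in H, then -1, the product of [- y] and the inverse of y, is in G and so
    in H. *)
Lemma pm_capl G H : matrix_group G -> matrix_group H -> H `<=` G ->
  (G (- 1%:M) -> H (- 1%:M)) -> pm H `&` G `<=` H.
Proof.
move=> [_ _ GM _] [HU _ HM HV] HG N1 x [[//|[y Hy <-]] GNy].
rewrite -[y]mul1mx -mulNmx; apply: HM => //.
apply: N1; have -> : - 1%:M = - y *m invmx y by rewrite mulNmx mulmxV ?HU.
by apply: GM => //; apply/HG/HV.
Qed.

Lemma mem_lcoset H x y : x \in unitmx -> lcoset H x y <-> H (invmx x *m y).
Proof.
move=> xu; split=> [[h Hh <-]|Hxy]; first by rewrite mulKmx.
by exists (invmx x *m y); rewrite ?mulKVmx.
Qed.

Lemma lcoset_refl H x : matrix_group H -> lcoset H x x.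
Proof. by case=> _ H1 _ _; exists 1%:M; rewrite ?mulmx1. Qed.

Lemma lcoset_eq H x y : matrix_group H -> lcoset H x y -> lcoset H y = lcoset H x.
Proof.
move=> [HU _ HM HV] [h Hh <-]; apply/seteqP; split=> _ [h' Hh' <-].
  by exists (h *m h'); [apply: HM|rewrite mulmxA].
exists (invmx h *m h'); first by apply: HM => //; apply: HV.
by rewrite -mulmxA mulKVmx //; apply: HU.
Qed.

Lemma coset_map_lcoset G H x : matrix_group G -> matrix_group H -> H `<=` G ->
  coset_map G (lcoset H x) = lcoset G x.
Proof.
move=> Ggrp Hgrp HG; apply/seteqP; split=> [y [z [h /HG Gh <-]]|y xy].
  by rewrite (@lcoset_eq G x) //; exists h.
by exists x => //; apply: lcoset_refl.
Qed.

(** Injectivity is [pm_capl]; for surjectivity, each coset of G in [pm G] is that of 1 or of -1, and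
    both lie in [pm H]. *)
Lemma pm_cosets_bij G H : matrix_group G -> matrix_group H -> H `<=` G ->
    (G (- 1%:M) -> H (- 1%:M)) ->
  set_bij (cosets (pm H) H) (cosets (pm G) G) (coset_map G).
Proof.
move=> Ggrp Hgrp HG N1.
have [pmU _ pmM pmV] := pm_matrix_group Hgrp; have [_ H1 _ _] := Hgrp.
split.
- move=> _ [x [Hx|[y Hy <-]] <-]; rewrite coset_map_lcoset //.
    by exists x => //; left; apply: HG.
  by exists (- y) => //; apply: pmN; left; apply: HG.
- move=> C C'; rewrite !inE => -[x Hx <-] [y Hy <-]; rewrite !coset_map_lcoset // => e.
  apply/lcoset_eq => //; apply/mem_lcoset; first exact: pmU.
  apply: (pm_capl Ggrp) => //; split; first by apply: pmM => //; apply: pmV.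
  by apply/mem_lcoset; [exact: pmU|rewrite -e; apply: lcoset_refl].
- move=> _ [x [Gx|[y Gy <-]] <-].
    exists (lcoset H 1%:M); first by exists 1%:M => //; left.
    by rewrite coset_map_lcoset //; apply/esym/lcoset_eq => //; exists x; rewrite ?mul1mx.
  exists (lcoset H (- 1%:M)); first by exists (- 1%:M) => //; apply: pmN; left.
  rewrite coset_map_lcoset //; apply/esym/lcoset_eq => //.
  by exists y; rewrite ?mulNmx ?mul1mx.
Qed.

Lemma pm_cosets_trivial G : matrix_group G ->
  cosets (pm G) G = [set G] <-> G (- 1%:M).
Proof.
move=> Ggrp; have [_ G1 _ _] := Ggrp.
have lcoset1 x : G x -> lcoset G x = G.
  move=> Gx; rewrite -[RHS](_ : lcoset G 1%:M = G).
    by apply: lcoset_eq => //; exists x; rewrite ?mul1mx.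
  apply/seteqP; split=> [_ [h Gh <-]|h Gh]; first by rewrite mul1mx.
  by exists h; rewrite ?mul1mx.
split=> [e|GN1].
  have : cosets (pm G) G (lcoset G (- 1%:M)).
    by exists (- 1%:M) => //; apply: pmN; left.
  by rewrite e => <-; apply: lcoset_refl.
rewrite pm_id //; apply/seteqP; split=> [_ [x Gx <-]|_ ->]; first exact: lcoset1.
by exists 1%:M => //; apply: lcoset1.
Qed.

End SignedGroups.

(** * Failure of equidistribution for classes confined to a subgroup of index 2 *)

Section NoEquidistribution.
Variables (R : realType) (d : nat) (H : set 'M[Cpx R]_d).
Hypotheses (Hgrp : matrix_group H) (Hc : compact H) (HN1 : ~ H (- 1%:M)).

Let N_H : set 'M[Cpx R]_d := [set - x | x in H].

Let H_N_H : H `&` N_H = set0.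
Proof.
have [HU _ HM HV] := Hgrp; apply/seteqP; split=> // y [] /[swap] -[x Hx <-] HNx; apply: HN1.
have -> : - 1%:M = - x *m invmx x by rewrite mulNmx mulmxV ?HU.
by apply: HM => //; apply: HV.
Qed.

Let closed_H : closed H.
Proof. by apply: compact_closed Hc; apply: norm_hausdorff. Qed.

Let closed_N_H : closed N_H.
Proof.
have -> : N_H = -%R @^-1` H.
  apply/seteqP; split=> [_ [x Hx <-]|x Hx]; first by rewrite /= opprK.
  by exists (- x); rewrite ?opprK.
by apply: closed_comp => // x _; apply: opp_continuous.
Qed.

Let measurable_closed (A : set 'M[Cpx R]_d) : closed A -> measurable (A : set (borelM R d)).
Proof.
move=> cA; rewrite -[A]setCK; apply: measurableC; apply: sub_sigma_algebra.
exact: closed_openC.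
Qed.

(** The group is the disjoint union of H and its translate by -1, which have equal measure. *)
Lemma haar_pm_half mu : haar (pm H) mu -> fine (mu H) = 2^-1.
Proof.
move=> [mu1 _ mu_inv].
have muN : mu N_H = mu H.
  rewrite -(mu_inv (- 1%:M) H) //.
  - congr (mu _); apply/seteqP; split=> _ [x Hx <-]; exists x => //.
      by rewrite mulNmx mul1mx.
    by rewrite mulNmx mul1mx.
  - by apply: pmN; left; case: Hgrp.
  - exact: measurable_closed.
  - by left.
have muU : mu (H `|` N_H) = (mu H + mu N_H)%E.
  by apply: measureU => //; apply: measurable_closed.
move: mu1; rewrite -[pm H]/(H `|` N_H) muU muN.
case: (mu H) => [r| |] // [r1] /=.
by apply: (@mulfI _ 2); rewrite ?mulfV ?pnatr_eq0 // mulr_natl mulr2n.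
Qed.

Lemma not_equidistributed_pm (I : choiceType) (good : set I) (nm : I -> nat)
    (cls : I -> set 'M[Cpx R]_d) mu :
  haar (pm H) mu -> (forall v, good v -> cls v `<=` H) ->
  ~ equidistributed (pm H) good nm cls mu.
Proof.
(* The class function 1_H has averages 0 or 1 (0 when no place is counted, as x / 0
   = 0) but integral 1/2. *)
move=> mu_haar clsH; pose phi (C : set 'M[Cpx R]_d) : R := (`[< C `<=` H >])%:R.
have [_ pm1 _ _] := pm_matrix_group Hgrp.
have phiE x : pm H x -> phi (conj_class (pm H) x) = (`[< H x >])%:R.
  move=> Hx; congr (_%:R); congr (nat_of_bool _); apply/asbool_equiv_eq; split=> [|{}Hx].
    by apply; exists 1%:M; rewrite // mul1mx invmx1 mulmx1.
  by move=> _ [h Hh <-]; apply: pm_conj.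
have phi1 x : H x -> phi (conj_class (pm H) x) = 1.
  by move=> Hx; rewrite phiE ?asboolT //; left.
have phi0 x : N_H x -> phi (conj_class (pm H) x) = 0.
  move=> HNx; rewrite phiE; last by right.
  have nHx : ~ H x by move=> Hx; have : (H `&` N_H) x by []; rewrite H_N_H.
  by rewrite asboolF.
have closed_pmH : closed (pm H) by apply: closedU.
have f_cont : {within pm H, continuous (fun x => phi (conj_class (pm H) x))}.
  (* H and -H are closed and the function is constant on each of them. *)
  apply: withinU_continuous => //.
    apply: (@subspace_eq_continuous _ _ _ (fun=> 1 : R)).
      by move=> x /set_mem Hx; apply/esym/phi1.
    by move=> x; apply: cst_continuous.
  apply: (@subspace_eq_continuous _ _ _ (fun=> 0 : R)).
    by move=> x /set_mem Hx; apply/esym/phi0.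
  by move=> x; apply: cst_continuous.
move=> /(_ phi f_cont) /=.
have -> : \int[mu]_(x in pm H) phi (conj_class (pm H) x) = 2^-1.
  rewrite -(haar_pm_half mu_haar) /Rintegral; congr fine.
  transitivity (\int[mu]_(x in pm H) (\1_H x)%:E)%E.
    by apply: eq_integral => /= x /set_mem Hx; rewrite phiE // indicE.
  rewrite integral_indic; [|exact: measurable_closed..].
  by congr (mu _); apply/setIidl; left.
(* Both 0 and 1 are at distance 1/2 from the limit, so a single average within 1/4 of it is a
   contradiction. *)
move=> /cvgrPdist_lt /(_ 4^-1) [|N _ /(_ N (leqnn N))]; first by rewrite invr_gt0.
set U := [set v | _] => dist.
set a := (_ / _) in dist.
suff [a0|a1] : a = 0 \/ a = 1.
- by move: dist; rewrite a0 ltr_norml => /andP[_]; lra.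
- by move: dist; rewrite a1 ltr_norml => /andP[+ _]; lra.
(* An infinite U also has an empty [fset_set], so U is finite in the other case. *)
have [U0|U0] := eqVneq (fset_set U) fset0.
  by left; rewrite /a U0 cardfs0 invr0 mulr0.
have Ufin : finite_set U.
  by move: U0; rewrite /fset_set; case: pselect => //= _; rewrite eqxx.
right; rewrite /a fsbig_finite // (eq_big_seq (fun=> 1)).
  rewrite big_const_seq count_predT iter_addr addr0 divff //.
  by rewrite pnatr_eq0 cardfs_eq0.
move=> v; rewrite in_fset_set // => /set_mem[/clsH vH _].
by rewrite /phi asboolT.
Qed.

End NoEquidistribution.

Lemma equidistributed_eq (R : realType) (d : nat) (G : set 'M[Cpx R]_d)
    (I : choiceType) (good : set I) (nm : I -> nat)
    (cls cls' : I -> set 'M[Cpx R]_d) mu :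
  (forall v, good v -> cls v = cls' v) ->
  equidistributed G good nm cls mu -> equidistributed G good nm cls' mu.
Proof.
move=> clsE equi phi phi_cont upto; have := equi phi phi_cont.
apply: cvg_trans; apply: near_eq_cvg; apply: nearW => N /=; congr (_ / _).
by apply: eq_fsbigr => v /set_mem[/clsE ->].
Qed.

Theorem theorem7p43
  (R : realType) (K : fieldExtType rat) (iota : {rmorphism K -> algC})
  (* (V, psi) and its Hodge decomposition *)
  (d : nat) (n : int) (Psi : 'M[rat]_d) (H : int -> {vspace 'cV[Cpx R]_d})
  (hodge : hodge_structure n H) (polarized : polarization n Psi H)
  (weight_neq0 : n != 0)
  (* (V_DR, psi_DR) and the comparison isomorphisms *)
  (PsiDR : 'M[K]_d) (Fil : int -> {vspace 'cV[K]_d})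
  (cmp : {rmorphism K -> Cpx R} -> 'M[Cpx R]_d)
  (deRham : de_rham_data n Psi H PsiDR Fil cmp)
  (* the ring D *)
  (D : set 'M[rat]_d) (rhoe : (algC -> algC) -> 'M[rat]_d -> 'M[rat]_d)
  (rDR : 'M[rat]_d -> 'M[algC]_d)
  (hD1 : D1 H D) (hD2 : D2 iota D rhoe)
  (hDR1 : DR1 cmp iota D rDR) (hDR2 : DR2 n Fil cmp D)
  (* the l-adic representations, satisfying (R1)-(R4) *)
  (Q : forall l : primeT, Ql R l)
  (chi : forall l, (algC -> algC) -> Q l)
  (rho : forall l, (algC -> algC) -> 'M[Q l]_d)
  (system : compatible_system iota n Psi Fil D rhoe rDR chi rho)
  (* the algebraic Sato-Tate conjecture *)
  (ASTt_ : set algC -> subfunctor rat d)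
  (ast : forall l (L : set algC), map_functor (Q l) (d + 1) d)
  (res : forall L L' : set algC, map_functor rat d d)
  (conjecture : algebraic_sato_tate iota Psi chi rho ASTt_ ast res)
  (* the Sato-Tate groups *)
  (ST STt : set 'M[Cpx R]_d)
  (ST_max :
     maximal_compact (pm (ASTt_ (baseK iota) (Cpx R) ratr)) ST)
  (STt_max : maximal_compact (ASTt_ (baseK iota) (Cpx R) ratr) STt)
  (ST_pm : ST = pm STt)
  (* the Frobenius elements *)
  (l : primeT) (emb : {rmorphism Q l -> Cpx R})
  (E : set (set K)) (E_finite : finite_set E)
  (E_good : forall v, prime_place iota v -> ~ E v ->
     good_place iota n (@rho l) v)
  (Fr : set K -> algC -> algC)
  (Fr_frob : forall v, prime_place iota v -> ~ E v ->
     is_frobenius iota v (Fr v)) :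
  let ASTt := ASTt_ (baseK iota) (Cpx R) ratr in
  let AST := pm ASTt in
  let PST := cosets AST ASTt in
  let trivial_PST := PST = [set ASTt] in
  let sato_tate_ST :=
    sato_tate iota E ST (frob_class iota n emb (@rho l) Fr AST ST) in
  let sato_tate_STt :=
    sato_tate iota E STt
      (frob_class_tilde iota n emb (@chi l) (@rho l) Fr
         (ast l (baseK iota) (Cpx R) emb) ASTt STt) in
  [/\ (* AST / ASTt = ST / STt *)
      set_bij (cosets ST STt) PST (coset_map ASTt),
      trivial_PST <-> STt (- 1%:M),
      ~ trivial_PST -> ~ sato_tate_ST
    & trivial_PST -> (sato_tate_ST <-> sato_tate_STt)].
Proof.
move=> ASTt AST PST trivial_PST sato_tate_ST sato_tate_STt.
have base := finite_ext_base iota.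
have [/(_ _ base)[[Galg _] _] /(_ l _ base)[[[ast_G _ _] _] astE] _ _ _] := conjecture.
have [chiP rhoP _ _ _] := system.
have Ggrp : matrix_group ASTt := Galg.2 (Cpx R) ratr.
have [STt_grp STtG STt_compact _] := STt_max.
have [_ _ ST_compact _] := ST_max.
have G_N1 : ASTt (- 1%:M) -> STt (- 1%:M).
  by apply: maximal_compact_N1 Ggrp STt_max _; rewrite -ST_pm.
have trivialP : trivial_PST <-> STt (- 1%:M).
  rewrite /trivial_PST /PST /AST pm_cosets_trivial //.
  by split=> [/G_N1|/STtG].
pose nf := norm_frob iota n emb (@rho l) Fr.
(* The block matrix of s and 1 lies in the kernel of N, where [ast] takes the upper left block;
   hence s is in [ASTt]. *)
have ss_ast v s : prime_place iota v -> ~ E v -> ss_part (nf v) s ->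
    ASTt s /\ ast l (baseK iota) (Cpx R) emb (block_mx s 0 0 1%:M) = s.
  move=> v_prime vE nf_s.
  have cl := ss_part_zariski_closure (chiP l) (rhoP l) (E_good v v_prime vE)
    (Fr_frob v v_prime vE) nf_s.
  have cl1 : Gt1_alg chi rho (baseK iota) emb (block_mx s 0 0 1%:M).
    by split; rewrite ?block_mxKdr.
  have ast_s : ast l (baseK iota) (Cpx R) emb (block_mx s 0 0 1%:M) = s.
    by rewrite (astE _ _ _ cl1) block_mxKul.
  split=> //; have := ast_G _ _ _ cl1; rewrite ast_s /subfunctor_bc.
  by rewrite (algebraic_group_eq Galg (g := ratr)) //; apply: fmorph_eq_rat.
split=> //.
- by rewrite ST_pm; apply: pm_cosets_bij.
- move=> trivialN [mu]; rewrite ST_pm => mu_haar.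
  have STt_N1 : ~ STt (- 1%:M) by move=> /trivialP.
  apply: not_equidistributed_pm mu_haar _ => // v [v_prime vE] x.
  move=> [STx [s nf_s [h Gh]] xE].
  have [Gs _] := ss_ast v s v_prime vE nf_s.
  (* A class of [ST] consists of conjugates of s under [AST], which normalizes [ASTt]; they lie in
     both [pm STt] and [ASTt], hence in [STt]. *)
  apply: (pm_capl Ggrp) => //; split=> //.
  by rewrite -xE; apply: pm_conj.
- move=> /trivialP STt_N1; have G1 := STtG _ STt_N1.
  have ASTE : AST = ASTt by apply: pm_id.
  have STE : ST = STt by rewrite ST_pm; apply: pm_id.
  have clsE v : prime_place iota v -> ~ E v ->
      frob_class iota n emb (@rho l) Fr AST ST v =
      frob_class_tilde iota n emb (@chi l) (@rho l) Fr
         (ast l (baseK iota) (Cpx R) emb) ASTt STt v.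
    move=> v_prime vE; have v_good := E_good v v_prime vE.
    have v_frob := Fr_frob v v_prime vE.
    have nfU := norm_frob_unit (rhoP l) emb v_frob.
    rewrite /frob_class /frob_class_tilde ASTE STE.
    rewrite (norm_frob_tildeE (chiP l) emb v_good v_frob).
    (* Semisimple parts of the two normalized Frobenius matrices correspond by adding or removing
       the last diagonal entry 1. *)
    apply/seteqP; split=> x [STx [s ss_s xs]]; split=> //.
      exists (block_mx s 0 0 1%:M); first exact: ss_part_block (ss_part1 _ _).
      by have [_ ->] := ss_ast v s v_prime vE ss_s.
    have [nf_s sE] := ss_part_block1 nfU ss_s; exists (ulsubmx s) => //.
    by have [_ <-] := ss_ast v _ v_prime vE nf_s; rewrite -sE.
  rewrite /sato_tate_ST /sato_tate_STt /sato_tate; rewrite STE in clsE *.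
  by split=> -[mu mu_haar equi]; exists mu => //;
    apply: equidistributed_eq equi => v [v_prime vE]; rewrite clsE.
Qed.
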